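(* Let $\Phi=\begin{bmatrix}\phi_1&\phi_2\\ \phi_3&\phi_4\end{bmatrix}\in L^\infty_{M_2}(\mathbb{T})$, and let $C:H^2_{\mathbb{C}^2}(\mathbb{D})\to H^2_{\mathbb{C}^2}(\mathbb{D})$ be the conjugation on $H^2_{\mathbb{C}^2}(\mathbb{D})$ whose block matrix representation is $$C=\frac{1}{\sqrt{2}}\begin{bmatrix}C_2&C_2\\ C_2&-C_2\end{bmatrix},$$ where $C_2$ is the conjugation on $H^2_{\mathbb{C}}(\mathbb{D})$ given by $$C_2\Big(\sum_{k=0}^{\infty}\big(a_{2k}z^{2k}+a_{2k+1}z^{2k+1}\big)\Big)=\sum_{k=0}^{\infty}\big(\overline{a_{2k+1}}\,z^{2k}+\overline{a_{2k}}\,z^{2k+1}\big).$$ Then the block Toeplitz operator $T_\Phi$ is complex symmetric with respect to $C$ if and only if for all $l\in\mathbb{Z}$ and all $1\leq i\leq 4$, $$\widehat{\phi_1+\phi_2}(2l)=\widehat{\phi_1+\phi_2}(-2l),\quad \widehat{\phi_3-\phi_4}(2l)=\widehat{\phi_3-\phi_4}(-2l),\quad \widehat{\phi_1-\phi_2}(2l)=\widehat{\phi_3+\phi_4}(-2l),\quad \hat{\phi}_i(2l+1)=0.$$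
   Context: $\mathbb{D}$ is the open unit disc and $\mathbb{T}$ the unit circle in $\mathbb{C}$. $H^2_{\mathbb{C}}(\mathbb{D})$ is the Hardy space of power series $f(z)=\sum_{n\ge0}a_nz^n$ with $a_n\in\mathbb{C}$ and $\|f\|^2=\sum_{n\ge 0}|a_n|^2<\infty$, identified with a closed subspace of $L^2(\mathbb{T})$ (normalized Lebesgue measure). $H^2_{\mathbb{C}^2}(\mathbb{D})=H^2_{\mathbb{C}}(\mathbb{D})\otimes\mathbb{C}^2=H^2_{\mathbb{C}}(\mathbb{D})\oplus H^2_{\mathbb{C}}(\mathbb{D})$ is the $\mathbb{C}^2$-valued Hardy space, a closed subspace of $L^2_{\mathbb{C}^2}(\mathbb{T})=L^2(\mathbb{T})\otimes\mathbb{C}^2$ with orthogonal projection $\widetilde{P}$ onto it. $L^\infty_{M_2}(\mathbb{T})$ is the set of $2\times2$ matrices with entries $\phi_i\in L^\infty(\mathbb{T})$, and $T_\Phi f=\widetilde P(\Phi f)$, i.e. $T_\Phi=\begin{bmatrix}T_{\phi_1}&T_{\phi_2}\\ T_{\phi_3}&T_{\phi_4}\end{bmatrix}$, where $T_{\phi}f=P(\phi f)$ on $H^2_{\mathbb{C}}(\mathbb{D})$ with $P:L^2(\mathbb{T})\to H^2_{\mathbb{C}}(\mathbb{D})$ the orthogonal projection. For $\psi\in L^\infty(\mathbb{T})$, $\hat\psi(k)$ is the $k$-th Fourier coefficient ($k\in\mathbb{Z}$), and $\widehat{\phi_i\pm\phi_j}(k)$ denotes the $k$-th Fourier coefficient of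 $\phi_i\pm\phi_j$. A conjugation on a complex Hilbert space is a conjugate linear isometric map $C$ with $C^2=I$; a bounded operator $T$ is complex symmetric with respect to $C$ if $CTC=T^*$. *)

(* Defs.v *)
From HB Require Import structures.
From mathcomp Require Import all_boot all_order all_algebra.
From mathcomp Require Import complex.
From mathcomp Require Import all_classical all_reals all_analysis.
From mathcomp Require Import ring lra zify.

Set Implicit Arguments.
Unset Strict Implicit.
Unset Printing Implicit Defensive.

Import Order.TTheory GRing.Theory Num.Theory.
Import numFieldNormedType.Exports.

Local Open Scope classical_set_scope.
Local Open Scope ring_scope.
Local Open Scope complex_scope.

Section ComplexSymmetric.
Context (R : realType) (E : lmodType R[i]) (ip : E -> E -> R[i]).
Implicit Types C T S : E -> E.

(* [ip x x] is the square of the norm of [x]. *)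
Definition conjugation C : Prop :=
  [/\ forall (a : R[i]) x y, C (a *: x + y) = conjc a *: C x + C y,
      forall x, ip (C x) (C x) = ip x x
    & forall x, C (C x) = x].

(* [S] is the Hilbert space adjoint of [T]; for a bounded [T] it exists and
   this determines it. *)
Definition is_adjoint T S : Prop := forall x y, ip (T x) y = ip x (S y).

(* C T C = T^* *)
Definition complex_symmetric C T : Prop := is_adjoint T (C \o T \o C).

End ComplexSymmetric.

Section Circle.
Context (R : realType).

(* A function on the unit circle is represented by a function R[i] -> R[i], of
   which only the values on the circle, read through t |-> e^{it}, matter. *)
Definition expi (t : R) : R[i] := cos t +i* sin t.

Lemma twopi_gt0 : 0 < 2 * pi :> R.
Proof. by rewrite mulr_gt0 ?pi_gt0. Qed.

Definition circle_measure : probability _ R := uniform_prob twopi_gt0.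

Definition circle_integral (f : R[i] -> R[i]) : R[i] :=
  Rintegral circle_measure setT (fun t => complex.Re (f (expi t))) +i*
  Rintegral circle_measure setT (fun t => complex.Im (f (expi t))).

(* L^p of the circle, for p = 2%:E and p = +oo; functions equal almost
   everywhere are not identified. *)
Definition circle_Lp (p : \bar R) (f : R[i] -> R[i]) : Prop :=
  (fun t => complex.Re (f (expi t))) \in Lfun circle_measure p /\
  (fun t => complex.Im (f (expi t))) \in Lfun circle_measure p.

Definition L2_ip (f g : R[i] -> R[i]) : R[i] :=
  circle_integral (fun z => f z * conjc (g z)).

Definition L2_cvg (f_ : (R[i] -> R[i])^nat) (g : R[i] -> R[i]) : Prop :=
  (fun n => \int[circle_measure]_t
     (ComplexField.Normc.normc (f_ n (expi t) - g (expi t)) ^+ 2)%:E)%E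
  @ \oo --> 0%E.

Definition fourier (f : R[i] -> R[i]) (k : int) : R[i] :=
  circle_integral (fun z => f z * z ^ (- k)).

End Circle.

Section Hardy.
Context (R : realType).
Local Notation normc := ComplexField.Normc.normc.

Definition square_summable : {pred nat -> R[i]^o} :=
  [pred a : nat -> R[i]^o | `[< cvgn (series (fun n => normc (a n) ^+ 2)) >]].

Lemma square_summableP (a : nat -> R[i]^o) :
  reflect (cvgn (series (fun n => normc (a n) ^+ 2))) (a \in square_summable).
Proof. exact: asboolP. Qed.

Lemma sqr_normcE (z : R[i]) :
  normc z ^+ 2 = complex.Re z ^+ 2 + complex.Im z ^+ 2.
Proof. by case: z => x y /=; rewrite sqr_sqrtr// addr_ge0// sqr_ge0. Qed.

Lemma sqr_normcD (k z w : R[i]) :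
  normc (k * z + w) ^+ 2 <= 2 * normc k ^+ 2 * normc z ^+ 2 + 2 * normc w ^+ 2.
Proof.
rewrite !sqr_normcE; case: k z w => [k1 k2] [x1 x2] [y1 y2] /=.
have := sqr_ge0 (k1 * x1 - k2 * x2 - y1).
have := sqr_ge0 (k1 * x2 + k2 * x1 - y2).
nra.
Qed.

Lemma square_summable_submod : submod_closed square_summable.
Proof.
split=> [|k a b].
  apply/square_summableP.
  have -> : series (fun n => normc ((0 : nat -> R[i]^o) n) ^+ 2) = cst 0.
    apply/funext => n; apply: big1 => i _.
    by rewrite sqr_normcE /= expr0n addr0.
  exact: is_cvg_cst.
move=> /square_summableP ca /square_summableP cb; apply/square_summableP.
pose u n := (2 * normc k ^+ 2) * normc (a n) ^+ 2.
pose v n := 2 * normc (b n) ^+ 2.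
apply: (@series_le_cvg _ _ (fun n => u n + v n)).
- by move=> n; rewrite sqr_ge0.
- move=> n; have s0 z : 0 <= normc z ^+ 2 by rewrite sqr_ge0.
  exact: addr_ge0 (mulr_ge0 (mulr_ge0 (ler0n _ 2) (s0 _ k)) (s0 _ (a n)))
                  (mulr_ge0 (ler0n _ 2) (s0 _ (b n))).
- by move=> n; exact: sqr_normcD.
- have -> : series (fun n => u n + v n) = series u + series v.
    by apply/funext => n; rewrite /series/= big_split.
  apply: is_cvgD.
    exact: (@is_cvg_seriesZ R (fun n => normc (a n) ^+ 2) _ ca).
  exact: (@is_cvg_seriesZ R (fun n => normc (b n) ^+ 2) _ cb).
Qed.

HB.instance Definition _ := GRing.isSubmodClosed.Build _ _ square_summable
  square_summable_submod.

(* An element of H^2, given by its Taylor coefficients. *)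
Record hardy := Hardy {
  coef :> nat -> R[i]^o;
  coefP : coef \in square_summable }.

HB.instance Definition _ := [isSub for coef].
HB.instance Definition _ := [Choice of hardy by <:].
HB.instance Definition _ := [SubChoice_isSubLmodule of hardy by <:].

Definition hardy_ip (f g : hardy) : R[i] :=
  limn (series (fun n => complex.Re ((f n : R[i]) * conjc (g n : R[i])))) +i*
  limn (series (fun n => complex.Im ((f n : R[i]) * conjc (g n : R[i])))).

(* The embedding of H^2 in L^2: a representative of the L^2-limit of the
   partial sums of the power series of [f]. *)
Definition boundary (f : hardy) : R[i] -> R[i] :=
  xget (fun=> 0) [set g | circle_Lp 2%:E g /\
    L2_cvg (fun n z => \sum_(k < n) (f k : R[i]) * z ^+ k) g].

(* The orthogonal projection of L^2 onto H^2. *)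
Definition hardy_proj (g : R[i] -> R[i]) : hardy :=
  xget 0 [set h | forall k : hardy,
    L2_ip (fun z => g z - boundary h z) (boundary k) = 0].

Definition toeplitz (phi : R[i] -> R[i]) (f : hardy) : hardy :=
  hardy_proj (fun z => phi z * boundary f z).

Definition swap (n : nat) : nat := if odd n then n.-1 else n.+1.

Lemma sum_swap_double (u : nat -> R) n :
  \sum_(0 <= k < n.*2) u (swap k) = \sum_(0 <= k < n.*2) u k.
Proof.
elim: n => [|n IHn]; first by rewrite !big_nil.
rewrite doubleS !big_nat_recr//= IHn /swap /= odd_double /=.
by rewrite -!addrA [u _.+1 + _]addrC.
Qed.

Lemma cvg_series_swap (u : nat -> R) : (forall n, 0 <= u n) ->
  cvgn (series u) -> series (u \o swap) @ \oo --> limn (series u).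
Proof.
move=> u0 cu.
have cus : cvgn (series (u \o swap)).
  apply: nondecreasing_is_cvgn.
    by apply: nondecreasing_series => n _ _; exact: u0.
  exists (limn (series u)) => _ [n _ <-].
  apply: (@le_trans _ _ (series (u \o swap) n.*2)).
    apply: (@nondecreasing_series _ (u \o swap) xpredT 0 _ n n.*2); last by lia.
    by move=> k _ _; exact: u0.
  rewrite /series/= sum_swap_double.
  apply: nondecreasing_cvgn_le => //.
  by apply: nondecreasing_series => k _ _; exact: u0.
have c2 : (fun n => n.*2) @ \oo --> \oo.
  move=> A [N _ NA]; exists N => // n /= Nn; apply: NA => /=; lia.
have E : series u \o double = series (u \o swap) \o double.
  by apply/funext => n; rewrite /series/= sum_swap_double.
have -> : limn (series u) = limn (series (u \o swap)).
  have cu2 : series u \o double @ \oo --> limn (series u).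
    exact: (cvg_comp _ _ c2 cu).
  rewrite -(cvg_lim (@Rhausdorff R) cu2) E; apply: cvg_lim => //.
  exact: (cvg_comp _ _ c2 cus).
exact: cus.
Qed.

Lemma normc_conjc (z : R[i]) : normc (conjc z) = normc z.
Proof. by case: z => x y /=; rewrite sqrrN. Qed.

Lemma swap_summable (f : hardy) :
  (fun n => conjc (f (swap n) : R[i])) \in square_summable.
Proof.
apply/square_summableP.
have /square_summableP cf := coefP f.
under eq_fun do rewrite normc_conjc.
apply/cvg_ex; eexists.
by apply: (@cvg_series_swap (fun n => normc (f n) ^+ 2)) => // n;
  rewrite sqr_ge0.
Qed.

(* The conjugation C_2: the coefficients of z^(2k) and z^(2k+1) are conjugated
   and exchanged. *)
Definition swap_conj (f : hardy) : hardy := Hardy (swap_summable f).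

Local Notation hardy2 := (hardy * hardy)%type.

Definition hardy2_ip (f g : hardy2) : R[i] :=
  hardy_ip f.1 g.1 + hardy_ip f.2 g.2.

Definition block_conj (f : hardy2) : hardy2 :=
  (Num.sqrt 2)^-1%:C *: (swap_conj f.1 + swap_conj f.2,
                         swap_conj f.1 - swap_conj f.2).

Definition block_toeplitz (Phi : 'M[R[i] -> R[i]]_2) (f : hardy2) : hardy2 :=
  (toeplitz (Phi 0 0) f.1 + toeplitz (Phi 0 1) f.2,
   toeplitz (Phi 1 0) f.1 + toeplitz (Phi 1 1) f.2).

Lemma swapK : involutive swap.
Proof.
move=> n; rewrite /swap; case: (boolP (odd n)) => n2.
  by case: n n2 => //= n /negbTE ->.
by rewrite /= n2.
Qed.

Lemma swap_conjK : involutive swap_conj.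
Proof.
move=> f; apply: val_inj; apply/funext => n /=.
by rewrite swapK conjcK.
Qed.

Lemma swap_conjP (a : R[i]) f g :
  swap_conj (a *: f + g) = conjc a *: swap_conj f + swap_conj g.
Proof.
apply: val_inj; apply/funext => n /=.
change (conjc (a * (f (swap n) : R[i]) + g (swap n)) =
        conjc a * conjc (f (swap n) : R[i]) + conjc (g (swap n) : R[i])).
by rewrite rmorphD rmorphM.
Qed.

Lemma swap_conjD f g : swap_conj (f + g) = swap_conj f + swap_conj g.
Proof. by rewrite -{1}[f]scale1r swap_conjP rmorph1 scale1r. Qed.

Lemma swap_conj0 : swap_conj 0 = 0.
Proof. by apply: (addrI (swap_conj 0)); rewrite -swap_conjD !addr0. Qed.

Lemma swap_conjZ (a : R[i]) f : swap_conj (a *: f) = conjc a *: swap_conj f.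
Proof. by rewrite -{1}[a *: f]addr0 swap_conjP swap_conj0 addr0. Qed.

Lemma swap_conjB f g : swap_conj (f - g) = swap_conj f - swap_conj g.
Proof. by rewrite swap_conjD -scaleN1r swap_conjZ rmorphN rmorph1 scaleN1r. Qed.

Lemma hardy_sqr (f : hardy) :
  hardy_ip f f = (limn (series (fun n => normc (f n) ^+ 2)))%:C.
Proof.
rewrite /hardy_ip.
have -> : (fun n => complex.Re ((f n : R[i]) * conjc (f n : R[i]))) =
          (fun n => normc (f n) ^+ 2).
  apply/funext => n; rewrite sqr_normcE.
  by case: (f n) => x y /=; rewrite mulrN opprK !expr2.
have -> : (fun n => complex.Im ((f n : R[i]) * conjc (f n : R[i]))) = cst 0.
  by apply/funext => n; case: (f n) => x y /=; rewrite mulrN mulrC addNr.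
have -> : series (cst (0 : R)) = cst 0.
  by apply/funext => n; apply: big1.
by rewrite lim_cst.
Qed.

Lemma swap_conj_isom f : hardy_ip (swap_conj f) (swap_conj f) = hardy_ip f f.
Proof.
rewrite !hardy_sqr /=; congr (_%:C); apply: cvg_lim => //.
under eq_fun do rewrite normc_conjc.
apply: (@cvg_series_swap (fun n => normc (f n) ^+ 2)).
  by move=> n; rewrite sqr_ge0.
exact/square_summableP/coefP.
Qed.

Lemma sqrt2V_sqr (s := (Num.sqrt 2)^-1%:C : R[i]) : s * conjc s * 2%:R = 1.
Proof.
have -> : conjc s = s by exact: conjc_real.
rewrite /s -rmorphM -(rmorph_nat (real_complex R)) -rmorphM.
by rewrite -invfM -expr2 sqr_sqrtr ?ler0n// mulVf ?rmorph1 ?pnatr_eq0.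
Qed.

Lemma swap_conj_rotK (s : R[i]) f g : s * conjc s * 2%:R = 1 ->
  s *: (swap_conj (s *: (swap_conj f + swap_conj g)) +
        swap_conj (s *: (swap_conj f - swap_conj g))) = f /\
  s *: (swap_conj (s *: (swap_conj f + swap_conj g)) -
        swap_conj (s *: (swap_conj f - swap_conj g))) = g.
Proof.
move=> s2; rewrite !swap_conjZ swap_conjD swap_conjB !swap_conjK.
rewrite -scalerDr -scalerBr !scalerA opprB; split.
  by rewrite addrACA subrr addr0 -mulr2n -scaler_nat scalerA s2 scale1r.
by rewrite [f + g]addrC addrACA subrr addr0 -mulr2n -scaler_nat scalerA s2 scale1r.
Qed.

Lemma hardy_parallelogram (f g : hardy) (s := (Num.sqrt 2)^-1%:C : R[i]) :
  hardy_ip (s *: (f + g)) (s *: (f + g)) +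
  hardy_ip (s *: (f - g)) (s *: (f - g)) = hardy_ip f f + hardy_ip g g.
Proof.
have cvg (h : hardy) : cvgn (series (fun n => normc (h n) ^+ 2)).
  exact/square_summableP/coefP.
rewrite !hardy_sqr -!rmorphD; apply: congr1; rewrite -!lim_seriesD//.
congr (limn (series _)).
apply/funext => n.
change (normc (s * ((f n : R[i]) + g n)) ^+ 2 +
        normc (s * ((f n : R[i]) - g n)) ^+ 2 =
        normc (f n) ^+ 2 + normc (g n) ^+ 2).
rewrite /s; have : (Num.sqrt 2)^-1 * (Num.sqrt 2)^-1 = 2^-1 :> R.
  by rewrite -invfM -expr2 sqr_sqrtr ?ler0n.
rewrite !sqr_normcE; move: (_^-1) => r r2.
case: (f n) (g n) => [x1 y1] [x2 y2] /=.
rewrite !mul0r !subr0 !addr0 !exprMn expr2 r2.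
by field.
Qed.

Lemma block_conj_conjugation : conjugation hardy2_ip block_conj.
Proof.
split.
- move=> a [x1 x2] [y1 y2]; rewrite /block_conj.
  apply: injective_projections => /=.
    by rewrite !swap_conjP !scalerDr !scalerA [LHS]addrACA [conjc a * _]mulrC.
  rewrite !swap_conjP !(opprD, scalerDr, scalerN, scalerA).
  by rewrite [LHS]addrACA [conjc a * _]mulrC.
- move=> [x1 x2]; rewrite /hardy2_ip /= hardy_parallelogram.
  by rewrite !swap_conj_isom.
- move=> [x1 x2]; have [e1 e2] := swap_conj_rotK x1 x2 sqrt2V_sqr.
  exact: injective_projections.
Qed.

End Hardy.

(* Main.v *)
Require Import Defs.
From HB Require Import structures.
From mathcomp Require Import all_boot all_order all_algebra.
From mathcomp Require Import complex.
From mathcomp Require Import all_classical all_reals all_analysis.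
From mathcomp Require Import measurable_realfun ess_sup_inf.
From mathcomp Require Import ring lra zify.

(** The conjugation C is C_2 combined with a real symmetric orthogonal 2 x 2
    matrix of scalars, so that C T_Phi C = T_Phi^* is an identity between 2 x 2
    matrices of operators, with entries built from T_i := T_(phi_i) and
    C_2 T_i C_2. Adding and subtracting its entries decouples it into four
    scalar identities [complex_symmetricP]: for each of the pairs
    (phi_1 + phi_2, phi_1 + phi_2), (phi_3 - phi_4, phi_3 - phi_4),
    (phi_1 - phi_2, phi_3 + phi_4) and (phi_3 + phi_4, phi_1 - phi_2), taken as
    (phi, psi), one asks that C_2 (T_psi)^* C_2 = T_phi.

    Such an identity is decided on the basis of monomials
    [toeplitz_form_swapP]. As T_phi has the entry phi^(k - j) at (j, k), and C_2
    exchanges the monomials of index 2 m and 2 m + 1, the identity is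
    phi^(k - j) = psi^(swap j - swap k). Indices of equal parity give
    phi^(2 l) = psi^(- 2 l); indices of opposite parity give two expressions for
    phi^(2 l + 1), whose agreement makes the odd coefficients periodic, hence
    zero by the Riemann-Lebesgue lemma [fourier_periodic0]. The odd coefficients
    of phi_1 + phi_2, phi_1 - phi_2, phi_3 + phi_4 and phi_3 - phi_4 vanish
    exactly when those of all the phi_i do.

    The analysis consists in reaching these matrix entries. The
    characters z ^ n are orthonormal [L2_ip_monomial], L2 is complete
    [L2_complete], so the boundary values of a function of the Hardy space exist
    [boundary_spec] and the projection onto the Hardy space is given by Fourier
    coefficients [hardy_proj_spec]. Then <T_phi f, g> is the integral of phi f
    times the conjugate of g [toeplitz_formE], and by the Cauchy-Schwarz
    inequality it is continuous in each variable, so it is determined by its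
    values on monomials. *)

Set Implicit Arguments.
Unset Strict Implicit.
Unset Printing Implicit Defensive.

Import Order.TTheory GRing.Theory Num.Theory.
Import numFieldNormedType.Exports.

Local Open Scope classical_set_scope.
Local Open Scope ring_scope.
Local Open Scope complex_scope.

Local Notation normc := ComplexField.Normc.normc.
Local Notation Re := complex.Re.
Local Notation Im := complex.Im.

(** * Complex numbers and complex limits *)

Section ComplexParts.
Context (R : realType).
Implicit Types x y : R[i].

Lemma cReD x y : Re (x + y) = Re x + Re y. Proof. by case: x y => ? ? []. Qed.
Lemma cImD x y : Im (x + y) = Im x + Im y. Proof. by case: x y => ? ? []. Qed.
Lemma cReN x : Re (- x) = - Re x. Proof. by case: x. Qed.
Lemma cImN x : Im (- x) = - Im x. Proof. by case: x. Qed.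
Lemma cReM x y : Re (x * y) = Re x * Re y - Im x * Im y.
Proof. by case: x y => ? ? []. Qed.
Lemma cImM x y : Im (x * y) = Re x * Im y + Im x * Re y.
Proof. by case: x y => ? ? []. Qed.
Lemma cReJ x : Re (conjc x) = Re x. Proof. by case: x. Qed.
Lemma cImJ x : Im (conjc x) = - Im x. Proof. by case: x. Qed.

Lemma conjcD x y : conjc (x + y) = conjc x + conjc y.
Proof. exact: rmorphD. Qed.
Lemma conjcM x y : conjc (x * y) = conjc x * conjc y.
Proof. exact: rmorphM. Qed.

Lemma complex_ext x y : Re x = Re y -> Im x = Im y -> x = y.
Proof. by case: x y => ? ? [? ?] /= -> ->. Qed.

Lemma normc_ge0 x : 0 <= normc x.
Proof. by case: x => a b /=; exact: sqrtr_ge0. Qed.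

Lemma Re_normc x : `|Re x| <= normc x.
Proof.
by rewrite -sqrtr_sqr; case: x => a b /=; rewrite ler_wsqrtr// lerDl sqr_ge0.
Qed.

Lemma Im_normc x : `|Im x| <= normc x.
Proof.
by rewrite -sqrtr_sqr; case: x => a b /=; rewrite ler_wsqrtr// lerDr sqr_ge0.
Qed.

(** Limits of complex sequences are measured by the modulus, so that every
    convergence statement is about a sequence of real numbers. *)
Definition ccvg (u : nat -> R[i]) (l : R[i]) : Prop :=
  (fun n => normc (u n - l)) @ \oo --> 0.

Lemma ccvgP (u : nat -> R[i]) l :
  ccvg u l <-> (fun n => Re (u n)) @ \oo --> Re l /\
               (fun n => Im (u n)) @ \oo --> Im l.
Proof.
split=> [ul|[cr ci]].
  have cle (v : nat -> R) (b : R) : (forall n, `|b - v n| <= normc (u n - l)) ->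
      v @ \oo --> b.
    move=> vu; apply/cvgrPdist_le => e e0.
    move/cvgrPdist_le: ul => /(_ e e0); apply: filterS => n.
    by rewrite sub0r normrN ger0_norm ?normc_ge0//; apply: le_trans.
  split; apply: cle => n; rewrite distrC.
    by rewrite -cReN -cReD Re_normc.
  by rewrite -cImN -cImD Im_normc.
apply: (@squeeze_cvgr _ _ _ _ (cst 0)
  (fun n => `|Re (u n) - Re l| + `|Im (u n) - Im l|)).
- apply: nearW => n; rewrite normc_ge0/=.
  rewrite -cReN -cImN -cReD -cImD.
  case: (u n - l) => a b /=.
  rewrite -(ler_pXn2r (ltn0Sn 1)) ?nnegrE ?sqrtr_ge0 ?addr_ge0//.
  rewrite sqr_sqrtr ?addr_ge0 ?sqr_ge0//.
  by rewrite sqrrD !real_normK ?num_real// addrAC lerDl mulrn_wge0// mulr_ge0.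
- exact: cvg_cst.
- rewrite -[X in _ --> X](addr0 (0 : R)).
  by apply: cvgD; apply/norm_cvg0P; apply/subr_cvg0.
Qed.

End ComplexParts.

(** * The inner product of L2 of the circle *)

Section Circle.
Context (R : realType).
Local Notation mu := (@circle_measure R).
Local Notation T := (measurableTypeR R).
Local Notation fn := (R[i] -> R[i]).
Local Notation L2 := (@circle_Lp R 2%:E).
Implicit Types f g h : fn.

Definition circle_integrable f : Prop :=
  mu.-integrable setT (EFin \o (fun t => Re (f (expi t)))) /\
  mu.-integrable setT (EFin \o (fun t => Im (f (expi t)))).

Let iZ (c : R) (u : T -> R) : mu.-integrable setT (EFin \o u) ->
  mu.-integrable setT (EFin \o (fun t => c * u t)).
Proof.
by move=> iu; exact: (@integrableZl _ T _ _ _ measurableT c (EFin \o u)).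
Qed.

Let iB (u v : T -> R) : mu.-integrable setT (EFin \o u) ->
  mu.-integrable setT (EFin \o v) ->
  mu.-integrable setT (EFin \o (fun t => u t - v t)).
Proof.
move=> iu iv.
exact: (@integrableB _ T _ _ _ measurableT (EFin \o u) (EFin \o v)).
Qed.

Let iD (u v : T -> R) : mu.-integrable setT (EFin \o u) ->
  mu.-integrable setT (EFin \o v) ->
  mu.-integrable setT (EFin \o (fun t => u t + v t)).
Proof.
move=> iu iv.
exact: (@integrableD _ T _ _ _ measurableT (EFin \o u) (EFin \o v)).
Qed.

Lemma circle_integralMD (a : R[i]) f g :
  circle_integrable f -> circle_integrable g ->
  circle_integral (fun z => a * f z + g z) =
  a * circle_integral f + circle_integral g.
Proof.
move=> [rf jf] [rg jg]; rewrite /circle_integral.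
apply: complex_ext; rewrite !(cReD, cImD, cReM, cImM) /=.
  under eq_Rintegral do rewrite cReD cReM.
  rewrite RintegralD//; last by apply: iB; exact: iZ.
  by rewrite RintegralB ?RintegralZl//; exact: iZ.
under eq_Rintegral do rewrite cImD cImM.
rewrite RintegralD//; last by apply: iD; exact: iZ.
by rewrite RintegralD ?RintegralZl//; exact: iZ.
Qed.

Lemma eq_circle_integral f g : (forall t, f (expi t) = g (expi t)) ->
  circle_integral f = circle_integral g.
Proof.
by move=> fg; congr (_ +i* _); apply: eq_Rintegral => t _; rewrite fg.
Qed.

Lemma circle_integralJ f : circle_integrable f ->
  circle_integral (fun z => conjc (f z)) = conjc (circle_integral f).
Proof.
move=> [rf jf]; apply: complex_ext; rewrite ?cReJ ?cImJ /=.
  by apply: eq_Rintegral => t _; rewrite cReJ.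
rewrite -mulN1r -RintegralZl//.
by apply: eq_Rintegral => t _; rewrite cImJ mulN1r.
Qed.

(** Membership in L2 phrased so that products and domination by an integrable
    function can be used directly. *)
Lemma Lfun2P (u : T -> R) : u \in Lfun mu 2%:E <->
  measurable_fun setT u /\ mu.-integrable setT (EFin \o (fun t => u t ^+ 2)).
Proof.
split=> [u2|[mu2 iu]].
  split; last exact: Lfun2_integrable_sqr.
  by move: u2; rewrite inE => /andP[/[!inE]].
rewrite inE; apply/andP; split; first by rewrite inE.
rewrite !inE/= /finite_norm unlock /Lnorm poweR_lty//.
have /integrableP[_] := iu; apply: le_lt_trans.
rewrite le_eqVlt; apply/orP; left; apply/eqP/eq_integral => t _.
by rewrite /= powR_mulrn ?normr_ge0// normrX.
Qed.

Lemma Lfun2D (u v : T -> R) : u \in Lfun mu 2%:E -> v \in Lfun mu 2%:E ->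
  (fun t => u t + v t) \in Lfun mu 2%:E.
Proof.
move=> u2 v2.
have p1 : (1 <= 2%:E :> \bar R)%E by rewrite lee1n.
have [_ h] := @Lfun_addr_closed _ _ _ mu 2%:E p1.
exact: h.
Qed.

Lemma Lfun2Z (c : R) (u : T -> R) : u \in Lfun mu 2%:E ->
  (fun t => c * u t) \in Lfun mu 2%:E.
Proof.
have p1 : 1 <= 2 :> R by rewrite ler1n.
move=> /(@Lfun_scale _ _ _ mu _ c _ p1).
suff -> : (fun t => c * u t) = c \o* u by [].
by apply/funext => t /=; rewrite mulrC.
Qed.

Lemma Lfun2N (u : T -> R) : u \in Lfun mu 2%:E ->
  (fun t => - u t) \in Lfun mu 2%:E.
Proof.
move=> /(@Lfun2Z (-1)); suff -> : (fun t => - u t) = (fun t => -1 * u t) by [].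
by apply/funext => t; rewrite mulN1r.
Qed.

Lemma L2_MD (a : R[i]) f g : L2 f -> L2 g -> L2 (fun z => a * f z + g z).
Proof.
move=> [rf jf] [rg jg]; split.
  under eq_fun do rewrite cReD cReM.
  by apply: Lfun2D => //; apply: Lfun2D; [|apply: Lfun2N]; exact: Lfun2Z.
under eq_fun do rewrite cImD cImM.
by apply: Lfun2D => //; apply: Lfun2D; exact: Lfun2Z.
Qed.

Lemma L2_mul_integrable f g : L2 f -> L2 g ->
  circle_integrable (fun z => f z * conjc (g z)).
Proof.
move=> [rf jf] [rg jg].
have iM (u v : T -> R) : u \in Lfun mu 2%:E -> v \in Lfun mu 2%:E ->
    mu.-integrable setT (EFin \o (fun t => u t * v t)).
  by move=> u2 v2; apply/Lfun1_integrable; exact: Lfun2_mul_Lfun1.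
split.
  under [X in _ \o X]eq_fun do rewrite cReM cReJ cImJ mulrN opprK.
  by apply: iD; exact: iM.
under [X in _ \o X]eq_fun do rewrite cImM cReJ cImJ mulrN addrC.
by apply: iB; exact: iM.
Qed.

Lemma L2_ipMDl (a : R[i]) f g h : L2 f -> L2 g -> L2 h ->
  L2_ip (fun z => a * f z + g z) h = a * L2_ip f h + L2_ip g h.
Proof.
move=> f2 g2 h2; rewrite /L2_ip.
rewrite -circle_integralMD; do ?exact: L2_mul_integrable.
by apply: eq_circle_integral => t; rewrite mulrDl mulrA.
Qed.

Lemma L2_ipC f g : L2 f -> L2 g -> L2_ip f g = conjc (L2_ip g f).
Proof.
move=> f2 g2; rewrite /L2_ip -circle_integralJ; last exact: L2_mul_integrable.
by apply: eq_circle_integral => t; rewrite rmorphM /= conjcK mulrC.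
Qed.

Definition circle_nrm2 f : R :=
  Rintegral mu setT (fun t => normc (f (expi t)) ^+ 2).

Lemma circle_nrm2_ge0 f : 0 <= circle_nrm2 f.
Proof. by apply: Rintegral_ge0 => t _; rewrite sqr_ge0. Qed.

Lemma L2_ipxx f : L2_ip f f = (circle_nrm2 f)%:C.
Proof.
rewrite /L2_ip /circle_integral; apply: complex_ext => /=.
  apply: eq_Rintegral => t _; rewrite sqr_normcE cReM cReJ cImJ.
  by rewrite mulrN opprK !expr2.
rewrite -[RHS](mul0r (fine (mu setT))) -Rintegral_cst//.
by apply: eq_Rintegral => t _; rewrite cImM cReJ cImJ mulrN mulrC addNr.
Qed.

Lemma L2_normc_integrable f : L2 f ->
  mu.-integrable setT (EFin \o (fun t => normc (f (expi t)) ^+ 2)).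
Proof.
move=> [/Lfun2P[mr ir] /Lfun2P[mi ii]].
under [X in _ \o X]eq_fun do rewrite sqr_normcE.
exact: iD.
Qed.

Lemma L2_measurable f : L2 f ->
  measurable_fun setT (fun t : T => Re (f (expi t))) /\
  measurable_fun setT (fun t : T => Im (f (expi t))).
Proof. by move=> [/Lfun2P[mr ir] /Lfun2P[mi ii]]. Qed.

Lemma measurable_normc f : 
  measurable_fun setT (fun t : T => Re (f (expi t))) ->
  measurable_fun setT (fun t : T => Im (f (expi t))) ->
  measurable_fun setT (fun t : T => normc (f (expi t)) ^+ 2).
Proof.
move=> mr mi; under eq_fun do rewrite sqr_normcE.
by apply: measurable_funD; exact: measurable_funX.
Qed.

Lemma L2_intro f :
  measurable_fun setT (fun t : T => Re (f (expi t))) ->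
  measurable_fun setT (fun t : T => Im (f (expi t))) ->
  (\int[mu]_t (normc (f (expi t)) ^+ 2)%:E < +oo)%E -> L2 f.
Proof.
move=> mr mi fin.
have iN : mu.-integrable setT (EFin \o (fun t => normc (f (expi t)) ^+ 2)).
  apply/integrableP; split.
    by apply/measurable_EFinP; exact: measurable_normc.
  under eq_integral do rewrite /= ger0_norm ?sqr_ge0//.
  exact: fin.
split; apply/Lfun2P; split => //; apply: (le_integrable measurableT) iN => //=.
- by apply/measurable_EFinP; exact: measurable_funX.
- move=> t _; rewrite lee_fin !ger0_norm ?sqr_ge0//.
  by rewrite sqr_normcE lerDl sqr_ge0.
- by apply/measurable_EFinP; exact: measurable_funX.
- move=> t _; rewrite lee_fin !ger0_norm ?sqr_ge0//.
  by rewrite sqr_normcE lerDr sqr_ge0.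
Qed.

Lemma circle_nrm2E f : L2 f ->
  (\int[mu]_t (normc (f (expi t)) ^+ 2)%:E)%E = (circle_nrm2 f)%:E.
Proof.
move=> f2; rewrite /circle_nrm2 /Rintegral fineK//.
exact: integrable_fin_num (L2_normc_integrable f2).
Qed.

Lemma L2_ipMDr (a : R[i]) f g h : L2 f -> L2 g -> L2 h ->
  L2_ip h (fun z => a * f z + g z) = conjc a * L2_ip h f + L2_ip h g.
Proof.
move=> f2 g2 h2; rewrite L2_ipC//; last exact: L2_MD.
by rewrite L2_ipMDl// conjcD conjcM -!L2_ipC.
Qed.

(** With w := <f, g>, the squared norm of f - t w g is a quadratic polynomial
    in t which is nonnegative everywhere. When g has norm 0 the polynomial is
    affine, and a large t forces w = 0; otherwise t := 1 / |g|^2 is optimal. *)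
Lemma L2_Cauchy_Schwarz f g : L2 f -> L2 g ->
  normc (L2_ip f g) ^+ 2 <= circle_nrm2 f * circle_nrm2 g.
Proof.
move=> f2 g2; set w := L2_ip f g.
have key (t : R) : 0 <= circle_nrm2 f - 2 * t * normc w ^+ 2 +
    t ^+ 2 * (normc w ^+ 2 * circle_nrm2 g).
  have tg2 : L2 (fun z => (- t%:C * w) * g z + f z) by exact: L2_MD.
  have := circle_nrm2_ge0 (fun z => (- t%:C * w) * g z + f z).
  have -> // : circle_nrm2 (fun z => (- t%:C * w) * g z + f z) =
    circle_nrm2 f - 2 * t * normc w ^+ 2 +
    t ^+ 2 * (normc w ^+ 2 * circle_nrm2 g).
  apply: (@complexI R); rewrite -L2_ipxx.
  rewrite L2_ipMDr// L2_ipMDl// L2_ipMDl// !L2_ipxx.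
  rewrite [L2_ip g f]L2_ipC// -/w sqr_normcE.
  by case: w {tg2} => x y; apply: complex_ext => /=; ring.
have := circle_nrm2_ge0 f; have := circle_nrm2_ge0 g.
have := sqr_ge0 (normc w).
move: key; move: (_ ^+ 2) (circle_nrm2 f) (circle_nrm2 g) => c a b key c0 b0 a0.
have [b1|b1] := eqVneq b 0.
  have := key ((a + 1) / (2 * c)).
  have [->|cn] := eqVneq c 0; first by rewrite mulr_ge0.
  rewrite b1 !mulr0 addr0 invfM.
  have -> : a - 2 * ((a + 1) * (2^-1 * c^-1)) * c = - 1 by field.
  by rewrite ler0N1.
have bp : 0 < b by rewrite lt_neqAle eq_sym b1.
have := key b^-1.
have -> : a - 2 * b^-1 * c + b^-1 ^+ 2 * (c * b) = (a * b - c) / b by field.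
by rewrite pmulr_lge0 ?invr_gt0// subr_ge0.
Qed.

End Circle.

(** * Characters of the circle *)

Section Monomials.
Context (R : realType).
Local Notation mu := (@circle_measure R).
Local Notation T := (measurableTypeR R).
Local Notation L2 := (@circle_Lp R 2%:E).

(** The uniform law integrates a nonnegative function as the normalized Lebesgue
    measure on [0, 2 pi], where the fundamental theorem of calculus applies. *)
Lemma circle_mean (f F : R -> R) : continuous f ->
  (forall t : R, is_derive t (1 : R) F (f t)) -> (forall t, 0 <= f t) ->
  Rintegral mu setT f = (F (2 * pi) - F 0) / (2 * pi).
Proof.
move=> cf dF f0.
have pi2 : 0 < 2 * pi :> R by rewrite mulr_gt0 ?pi_gt0.
have cF : continuous F.
  move=> t; apply: differentiable_continuous; apply/derivable1_diffP.
  by have [] := dF t.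
rewrite /Rintegral /circle_measure integral_uniform; last 2 first.
- by apply/measurable_EFinP; exact: continuous_measurable_fun.
- by move=> t; rewrite lee_fin.
rewrite (@continuous_FTC2 _ f F)//.
- by rewrite /= subr0 mulrC.
- exact: continuous_subspaceT.
- split; first by move=> t _; have [] := dF t.
  + exact: (cvg_at_right_filter (cF 0)).
  + exact: (cvg_at_left_filter (cF _)).
- by move=> t _; rewrite derive1E; have [_ ->] := dF t.
Qed.

Lemma expiD (s t : R) : expi (s + t) = expi s * expi t.
Proof. by apply: complex_ext; rewrite /= ?cosD ?sinD// addrC. Qed.

Lemma expiN (t : R) : expi (- t) = conjc (expi t).
Proof. by rewrite /expi cosN sinN. Qed.

Lemma expiX (t : R) n : expi t ^+ n = expi (n%:R * t).
Proof.
elim: n => [|n IHn]; first by rewrite expr0 mul0r /expi cos0 sin0.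
by rewrite exprSr IHn -expiD -natr1 mulrDl mul1r.
Qed.

Lemma normc_expi (t : R) : normc (expi t) = 1.
Proof. by rewrite /= cos2Dsin2 sqrtr1. Qed.

Lemma expi_neq0 (t : R) : expi t != 0.
Proof.
apply/eqP => e0; have := normc_expi t.
by rewrite e0 ComplexField.Normc.normc0 => /eqP; rewrite eq_sym oner_eq0.
Qed.

Lemma expiXJ (t : R) n : expi t ^+ n * conjc (expi t ^+ n) = 1.
Proof.
rewrite expiX -expiN -expiD subrr.
by apply: complex_ext; rewrite /= ?cos0 ?sin0.
Qed.

Lemma expi_2pi n : expi (n%:R * (2 * pi)) = 1 :> R[i].
Proof.
rewrite -expiX /expi.
by rewrite mulr_natl cos2pi sin2pi expr1n.
Qed.

Lemma is_derive_scale (f : R -> R) (c t d : R) : is_derive t (1 : R) f d ->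
  is_derive t (1 : R) (fun s => c * f s) (c * d).
Proof. by move=> df; exact: (@is_deriveZ R R^o R^o f c t 1 d). Qed.

(** The mean formula for nonnegative functions is applied after adding the
    constant 1, whose mean is known. *)
Lemma circle_mean_cos n :
  Rintegral mu setT (fun t => cos (n.+1%:R * t)) = 0 /\
  Rintegral mu setT (fun t => sin (n.+1%:R * t)) = 0.
Proof.
have pi2 : 2 * pi != 0 :> R by rewrite mulf_neq0 // gt_eqF ?pi_gt0.
have n0 : n.+1%:R != 0 :> R by rewrite pnatr_eq0.
have cm : continuous (fun t : R => n.+1%:R * t) by exact: mulrl_continuous.
have cc : continuous (fun t : R => cos (n.+1%:R * t)).
  by move=> t; apply: continuous_comp; [exact: cm|exact: continuous_cos].
have cs : continuous (fun t : R => sin (n.+1%:R * t)).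
  by move=> t; apply: continuous_comp; [exact: cm|exact: continuous_sin].
have bounded_int (u : T -> R) : continuous (u : R -> R) ->
    (forall t, `|u t| <= 1) -> mu.-integrable setT (EFin \o u).
  move=> cu u1.
  apply: (@measurable_bounded_integrable _ T R mu u setT measurableT).
  - by apply: (@le_lt_trans _ _ 1%E); [exact: probability_le1|exact: ltry].
  - exact: continuous_measurable_fun.
  - by exists 1; split => // M M1 t _; exact: le_trans (u1 t) (ltW M1).
have int1 : Rintegral mu setT (cst 1) = 1.
  rewrite Rintegral_cst//. rewrite mul1r.
  by have -> : fine (mu setT) = fine 1%E by congr fine; exact: probability_setT.
have shift (u : T -> R) : continuous (u : R -> R) -> (forall t, `|u t| <= 1) ->
    Rintegral mu setT (fun t => u t + 1) = 1 -> Rintegral mu setT u = 0.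
  move=> cu u1; rewrite RintegralD//.
  - by rewrite int1 => /(canRL (addrK _)) ->; rewrite subrr.
  - exact: bounded_int.
  - by apply: bounded_int => // [t|t]; [exact: cvg_cst|rewrite normr1].
have [c1 s0] := @expi_2pi n.+1.
pose lin (t : R) : R := n.+1%:R * t.
have dlin (t : R) : is_derive t (1 : R) lin n.+1%:R.
  have := @is_derive_scale id n.+1%:R t 1 (@is_derive_id R R^o t 1).
  by rewrite mulr1.
have prim (g g' : R -> R) (c : R) : c * n.+1%:R = 1 ->
    (forall t, is_derive t (1 : R) g (g' t)) ->
    forall t, is_derive t (1 : R) (fun s => c * g (lin s) + s) (g' (lin t) + 1).
  move=> c1' dg t; 
  apply: (@is_deriveD R R^o R^o (fun s => c * g (lin s)) id).
  have -> : g' (lin t) = c * (g' (lin t) * n.+1%:R) by rewrite mulrCA c1' mulr1.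
  exact: (@is_derive_scale (g \o lin)).
split.
- apply: shift => // [t|]; first exact: cos_max.
  rewrite (circle_mean _ (prim _ _ _ (mulVf n0) (@is_derive_sin R))).
  + by rewrite /lin s0 !(mulr0, sin0) addr0 add0r subr0 divff.
  + by move=> t; apply: continuousD; [exact: cc|exact: cvg_cst].
  + by move=> t; rewrite -lerBlDr sub0r cos_geN1.
- apply: shift => // [t|]; first exact: sin_max.
  have dcos (t : R) : is_derive t (1 : R) (fun x => - cos x) (sin t).
    by rewrite -[sin t]opprK; exact: (@is_deriveN R R^o R^o).
  rewrite (circle_mean _ (prim _ _ _ (mulVf n0) dcos)).
  + by rewrite /lin c1 mulr0 cos0 addr0 addrAC subrr add0r divff.
  + by move=> t; apply: continuousD; [exact: cs|exact: cvg_cst].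
  + by move=> t; rewrite -lerBlDr sub0r sin_geN1.
Qed.

End Monomials.

(** * Bounded symbols and Fourier coefficients *)

Section Fourier.
Context (R : realType).
Local Notation mu := (@circle_measure R).
Local Notation T := (measurableTypeR R).
Local Notation L2 := (@circle_Lp R 2%:E).
Implicit Types f g phi : R[i] -> R[i].

Lemma L2_monomial n : L2 (fun z => z ^+ n).
Proof.
have lin : continuous (fun t : R => n%:R * t) by exact: mulrl_continuous.
apply: L2_intro.
- under eq_fun do rewrite expiX.
  apply: continuous_measurable_fun => t.
  by apply: continuous_comp; [exact: lin|exact: continuous_cos].
- under eq_fun do rewrite expiX.
  apply: continuous_measurable_fun => t.
  by apply: continuous_comp; [exact: lin|exact: continuous_sin].
- under eq_integral do rewrite expiX normc_expi expr1n.
  rewrite integral_cst// mul1e.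
  by apply: (@le_lt_trans _ _ 1%E); [exact: probability_le1|exact: ltry].
Qed.

(** On the circle, z ^ j times the conjugate of z ^ k is z ^ (j - k), and every
    nonconstant character has mean zero. *)
Lemma L2_ip_monomial j k :
  L2_ip (fun z : R[i] => z ^+ j) (fun z => z ^+ k) = (j == k)%:R.
Proof.
wlog kj : j k / (k <= j)%N.
  move=> H; have [kj|/ltnW jk] := leqP k j; first exact: H.
  rewrite L2_ipC; [|exact: L2_monomial..].
  by rewrite H// eq_sym; case: eqP => _; rewrite ?conjc0 ?conjc1.
have -> : L2_ip (fun z : R[i] => z ^+ j) (fun z => z ^+ k) =
    circle_integral (fun z : R[i] => z ^+ (j - k)).
  apply: eq_circle_integral => t.
  by rewrite -{1}(subnK kj) exprD -mulrA expiXJ mulr1.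
have [<-|jk] := eqVneq j k.
  rewrite subnn; apply: complex_ext => /=.
    rewrite Rintegral_cst// mul1r.
    suff -> : fine (mu setT) = fine 1%E by [].
    by congr fine; exact: probability_setT.
  by rewrite Rintegral_cst// mul0r.
have [n ->] : exists n, (j - k)%N = n.+1 by exists (j - k).-1; lia.
have [c0 s0] := circle_mean_cos R n.
apply: complex_ext; [rewrite -[RHS]c0|rewrite -[RHS]s0].
  by apply: eq_Rintegral => t _; rewrite expiX.
by apply: eq_Rintegral => t _; rewrite expiX.
Qed.

Lemma Linf_bounded phi : circle_Lp +oo%E phi ->
  exists2 M : R, 0 <= M &
    {ae mu, forall t, normc (phi (expi t)) ^+ 2 <= M}.
Proof.
have bd (u : T -> R) : u \in Lfun mu +oo%E ->
    exists M : R, {ae mu, forall t, `|u t| <= M}.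
  rewrite inE => /andP[_ /[!inE]]; rewrite /= /finite_norm unlock /Lnorm.
  have -> : (0 < mu setT)%E.
    by apply: (@lt_le_trans _ _ 1%E); rewrite ?probability_setT.
  set s := ess_sup _ _ => soo; exists (fine s).
  have := ess_sup_ge mu (abse \o (EFin \o u)); rewrite -/s.
  apply: filterS => t /=.
  by case: s soo => //.
move=> [/bd[M1 b1] /bd[M2 b2]].
exists (M1 ^+ 2 + M2 ^+ 2); first by rewrite addr_ge0 ?sqr_ge0.
apply: filterS2 b1 b2 => t l1 l2.
rewrite sqr_normcE -(real_normK (num_real (Re _))).
rewrite -(real_normK (num_real (Im _))).
by rewrite lerD// lerXn2r// nnegrE (le_trans _ l1, le_trans _ l2).
Qed.

Lemma Linf_mul phi g : circle_Lp +oo%E phi -> L2 g ->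
  L2 (fun z => phi z * g z).
Proof.
move=> phioo g2; have [M M0 phiM] := Linf_bounded phioo.
have [mr mi] : measurable_fun setT (fun t : T => Re (phi (expi t))) /\
    measurable_fun setT (fun t : T => Im (phi (expi t))).
  case: phioo => pr pi; split.
    by move: pr; rewrite inE => /andP[/[!inE]].
  by move: pi; rewrite inE => /andP[/[!inE]].
have [gr gi] := L2_measurable g2.
have pgr : measurable_fun setT (fun t : T => Re (phi (expi t) * g (expi t))).
  under eq_fun do rewrite cReM.
  by apply: measurable_funB; exact: measurable_funM.
have pgi : measurable_fun setT (fun t : T => Im (phi (expi t) * g (expi t))).
  under eq_fun do rewrite cImM.
  by apply: measurable_funD; exact: measurable_funM.
have le : (\int[mu]_t (normc (phi (expi t) * g (expi t)) ^+ 2)%:E <=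
    (M * circle_nrm2 g)%:E)%E.
  rewrite EFinM -circle_nrm2E// -ge0_integralZl//.
  - apply: ae_ge0_le_integral => //.
    + by move=> t _; rewrite lee_fin sqr_ge0.
    + apply/measurable_EFinP.
      exact: (@measurable_normc _ (fun z => phi z * g z)).
    + by move=> t _; rewrite -EFinM lee_fin mulr_ge0 ?sqr_ge0.
    + apply/measurable_EFinP; apply: measurable_funM => //.
      exact: measurable_normc.
    + have [N [mN N0 phiN]] := phiM; exists N; split => //.
      apply: subset_trans phiN => t; apply: contra_not => tM _.
      rewrite -EFinM lee_fin.
      by rewrite ComplexField.Normc.normcM exprMn ler_wpM2r ?sqr_ge0.
  - by apply/measurable_EFinP; exact: measurable_normc.
  - by move=> t _; rewrite lee_fin sqr_ge0.
by apply: L2_intro => //; rewrite (le_lt_trans le) ?ltry.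
Qed.

(** The matrix of a Toeplitz operator in the basis of monomials is constant
    along diagonals. *)
Lemma fourierE phi j k :
  L2_ip (fun z => phi z * z ^+ j) (fun z => z ^+ k) =
  fourier phi (k%:Z - j%:Z).
Proof.
apply: eq_circle_integral => t; rewrite -mulrA; congr (_ * _).
rewrite opprB expfzDr ?expi_neq0//; congr (_ * _).
have ek0 : expi t ^+ k != 0 by rewrite expf_neq0 ?expi_neq0.
by apply: (mulfI ek0); rewrite expiXJ -exprnN divff.
Qed.

End Fourier.

(** * Completeness of L2 *)

Section Completeness.
Context (R : realType).
Local Notation mu := (@circle_measure R).
Local Notation T := (measurableTypeR R).
Local Notation L2 := (@circle_Lp R 2%:E).
Implicit Types f g : R[i] -> R[i].

Lemma L2_B f g : L2 f -> L2 g -> L2 (fun z => f z - g z).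
Proof.
move=> f2 g2; have -> : (fun z => f z - g z) = (fun z => -1 * g z + f z).
  by apply/funext => z; rewrite mulN1r addrC.
exact: L2_MD.
Qed.

Lemma bounded_normed_cvg (u v : nat -> R) (c : R) :
  (forall k, `|u k| <= v k) -> (forall n, \sum_(0 <= k < n) v k <= c) ->
  cvgn (series u).
Proof.
move=> uv vc; apply: normed_cvg; apply: nondecreasing_is_cvgn.
  by apply: nondecreasing_series => k _ _; exact: normr_ge0.
exists c => _ [n _ <-]; apply: le_trans (vc n).
by apply: ler_sum => k _; exact: uv.
Qed.

(** By monotone convergence, the sum of the |D k| has a finite integral, hence
    is finite almost everywhere: the series converges absolutely there. *)
Lemma ae_cvg_of_summable (D : nat -> T -> R) :
  (forall k, measurable_fun setT (D k)) ->
  (forall k, (\int[mu]_t `|D k t|%:E <= (2 * (2^-1) ^+ k)%:E)%E) ->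
  {ae mu, forall t : T, cvgn (series (fun k => D k t))}.
Proof.
move=> mD iD; pose v k t := `|D k t|%:E.
have mv k : measurable_fun setT (v k : T -> \bar R).
  by apply/measurable_EFinP; exact: measurableT_comp.
have v0 k t : (0 <= v k t)%E by rewrite lee_fin.
have sum_int : (\sum_(k <oo) \int[mu]_t v k t < +oo)%E.
  apply: (@le_lt_trans _ _ 4%:E); last exact: ltry.
  apply: lime_le.
    by apply: is_cvg_nneseries => k _ _; exact: integral_ge0.
  apply: nearW => n.
  apply: (@le_trans _ _ (\sum_(0 <= k < n) (2 * (2^-1 : R) ^+ k)%:E)%E).
    by apply: lee_sum => k _; exact: iD.
  rewrite sumEFin lee_fin.
  have half1 : `|2^-1| < 1 :> R by rewrite ger0_norm// invf_lt1// ltr1n.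
  apply: le_trans (@geometric_le_lim R n 2 2^-1 _ _ half1) _ => //.
  have -> : 1 - 2^-1 = 2^-1 :> R by field.
  by rewrite invrK -natrM.
have fin : mu.-integrable setT (fun t => (\sum_(k <oo) v k t)%E).
  apply/integrableP; split.
    by apply: ge0_emeasurable_sum => // k t _ _; exact: v0.
  under eq_integral => t _ do rewrite gee0_abs ?nneseries_ge0//.
  by rewrite integral_nneseries.
have [N [mN N0 aeN]] := integrable_ae measurableT fin.
exists N; split => //; apply: subset_trans aeN => t; apply: contra_not => /= vt.
have {}vt := vt Logic.I.
apply: (@bounded_normed_cvg _ (fun k => `|D k t|)
  (fine (\sum_(k <oo) v k t))%E) => // n.
rewrite -lee_fin fineK// -sumEFin.
exact: nneseries_lim_ge.
Qed.

(** The Riesz-Fischer theorem, with a Cauchy modulus [tail] that carries over to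
    the limit. Along a subsequence whose consecutive distances are at most 2^-k,
    the increments are absolutely summable almost everywhere, so the
    subsequence has a pointwise limit; Fatou's lemma transfers the modulus to
    it. The limit is taken pointwise in z, and therefore is a function on the
    circle. *)
Lemma L2_complete (S : nat -> R[i] -> R[i]) (tail : nat -> R) :
  (forall n, L2 (S n)) -> tail @ \oo --> 0 ->
  (forall m n, (n <= m)%N -> circle_nrm2 (fun z => S m z - S n z) <= tail n) ->
  exists2 g, L2 g & forall n, circle_nrm2 (fun z => g z - S n z) <= tail n.
Proof.
move=> S2 tail0 Scauchy.
have half0 k : 0 < (2^-1 : R) ^+ k by rewrite exprn_gt0 // invr_gt0.
(* The exponent 2 turns the bound on the squared distances into the rate 2^-k
   for the L1 norms. *)
have [nu [nuS nu_ge nu_tail]] : exists nu : nat -> nat,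
    [/\ forall k, (nu k <= nu k.+1)%N, forall k, (k <= nu k)%N &
        forall k, tail (nu k) <= ((2^-1) ^+ k) ^+ 2].
  have /choice[N NP] : forall k, exists N, forall n, (N <= n)%N ->
      tail n <= ((2^-1) ^+ k) ^+ 2.
    move=> k; move/cvgrPdist_le: tail0 => /(_ (((2^-1) ^+ k) ^+ 2)).
    have e0 : 0 < ((2^-1 : R) ^+ k) ^+ 2 by rewrite exprn_gt0.
    move=> /(_ e0)[N _ NP]; exists N => n /NP; rewrite /= sub0r normrN.
    exact: le_trans (ler_norm _).
  exists (fun k => \sum_(0 <= i < k.+1) N i + k)%N; split => k.
  - by rewrite [X in (_ <= X + _)%N]big_nat_recr//=; lia.
  - exact: leq_addl.
  - by apply: NP; rewrite big_nat_recr//=; lia.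
pose D k z := S (nu k.+1) z - S (nu k) z.
have D2 k : L2 (D k) by exact: L2_B.
have int_part (part : R[i] -> R) :
    (forall f, L2 f -> measurable_fun setT (fun t : T => part (f (expi t)))) ->
    (forall x, `|part x| <= normc x) -> forall k,
    (\int[mu]_t `|part (D k (expi t))|%:E <= (2 * (2^-1) ^+ k)%:E)%E.
  move=> mpart lepart k; set e := (2^-1) ^+ k.
  have e0 : 0 < e by exact: half0.
  (* The inequality |x| <= e^-1 * x ^ 2 + e bounds the L1 norm by the square of
     the L2 norm, the measure being a probability. *)
  apply: (@le_trans _ _
    (\int[mu]_t (e^-1 * normc (D k (expi t)) ^+ 2 + e)%:E)%E).
    apply: ge0_le_integral => //.
    - by apply/measurable_EFinP; apply: measurableT_comp => //; exact: mpart.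
    - apply/measurable_EFinP; apply: measurable_funD => //.
      apply: measurable_funM => //; have [] := L2_measurable (D2 k).
      exact: measurable_normc.
    - move=> t _; rewrite lee_fin; apply: le_trans (lepart _) _.
      move: (normc _) => x; rewrite -subr_ge0.
      have -> : e^-1 * x ^+ 2 + e - x =
          e^-1 * ((x - e / 2) ^+ 2 + 3 / 4 * e ^+ 2).
        by field; rewrite gt_eqF.
      rewrite mulr_ge0 ?invr_ge0 ?(ltW e0)// addr_ge0 ?sqr_ge0//.
      by rewrite mulr_ge0 ?sqr_ge0.
  have [mr mi] := L2_measurable (D2 k).
  have mn := measurable_normc mr mi.
  rewrite (@ge0_integralD _ T R mu setT measurableT
    (fun t => (e^-1 * normc (D k (expi t)) ^+ 2)%:E) (cst e%:E))//;
    last 3 first.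
  - by move=> t _; rewrite lee_fin mulr_ge0 ?invr_ge0 ?(ltW e0)// sqr_ge0.
  - by apply/measurable_EFinP; exact: measurable_funM.
  - by move=> t _; rewrite lee_fin ltW.
  have -> : (\int[mu]_t (e^-1 * normc (D k (expi t)) ^+ 2)%:E =
      (e^-1)%:E * \int[mu]_t (normc (D k (expi t)) ^+ 2)%:E)%E.
    rewrite -ge0_integralZl//.
    - exact/measurable_EFinP.
    - by move=> t _; rewrite lee_fin sqr_ge0.
    - by rewrite lee_fin invr_ge0 ltW.
  have -> : (\int[mu]_t cst e%:E t = e%:E)%E.
    rewrite integral_cst// -[RHS]mule1; congr (_ * _)%E.
    exact: probability_setT.
  rewrite circle_nrm2E// -EFinM -EFinD lee_fin.
  have Dk : circle_nrm2 (D k) <= e ^+ 2.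
    by apply: le_trans (nu_tail k); exact: Scauchy.
  rewrite mulrDl mul1r lerD2r mulrC ler_pdivrMr// -expr2 //.
have cvg_part (part : R[i] -> R) :
    (forall f, L2 f -> measurable_fun setT (fun t : T => part (f (expi t)))) ->
    (forall x, `|part x| <= normc x) ->
    (forall x y, part (x - y) = part x - part y) ->
    {ae mu, forall t : T, cvgn (fun k => part (S (nu k) (expi t)))}.
  move=> mpart lepart partB.
  have := @ae_cvg_of_summable (fun k t => part (D k (expi t))).
  move=> /(_ (fun k => mpart _ (D2 k)) (int_part _ mpart lepart)).
  move=> [N [mN N0 sN]]; exists N; split => //.
  apply: subset_trans sN => t; apply: contra_not => /= ct.
  have -> : (fun k => part (S (nu k) (expi t))) =
      (fun k => series (fun k => part (D k (expi t))) k +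
                part (S (nu 0%N) (expi t))).
    apply/funext => k; rewrite /series /=.
    under eq_bigr do rewrite partB.
    by rewrite telescope_sumr// subrK.
  by apply: is_cvgD => //; exact: is_cvg_cst.
(* An upper limit is measurable and agrees with the limit where it exists. *)
pose limpart (part : R[i] -> R) z :=
  fine (limn_esup (fun k => (part (S (nu k) z))%:E)).
have limpartE (part : R[i] -> R) z : cvgn (fun k => part (S (nu k) z)) ->
    (fun k => part (S (nu k) z)) @ \oo --> limpart part z.
  move=> c; rewrite /limpart.
  have ce : (fun k => (part (S (nu k) z))%:E) @ \oo -->
      (limn (fun k => part (S (nu k) z)))%:E.
    by apply/fine_cvgP; split => //; exact: nearW.
  by rewrite (cvg_limn_einf_sup ce).2.
have mlim (part : R[i] -> R) :
    (forall f, L2 f -> measurable_fun setT (fun t : T => part (f (expi t)))) ->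
    measurable_fun setT (fun t : T => limpart part (expi t)).
  move=> mpart; apply: measurableT_comp => //.
  apply: measurable_fun_limn_esup => k; apply/measurable_EFinP; exact: mpart.
pose g z := limpart (@complex.Re R) z +i* limpart (@complex.Im R) z.
have mRe f : L2 f -> measurable_fun setT (fun t : T => Re (f (expi t))).
  by move=> /L2_measurable[].
have mIm f : L2 f -> measurable_fun setT (fun t : T => Im (f (expi t))).
  by move=> /L2_measurable[].
have cg : {ae mu, forall t : T, ccvg (fun k => S (nu k) (expi t)) (g (expi t))}.
  have ReB (x y : R[i]) : Re (x - y) = Re x - Re y by rewrite cReD cReN.
  have ImB (x y : R[i]) : Im (x - y) = Im x - Im y by rewrite cImD cImN.
  have c1 := cvg_part _ mRe (@Re_normc R) ReB.
  have c2 := cvg_part _ mIm (@Im_normc R) ImB.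
  apply: filterS2 c1 c2 => t cr ci; apply/ccvgP.
  by split; [exact: limpartE cr|exact: limpartE ci].
have gr := mlim _ mRe; have gi := mlim _ mIm.
have fat n : (\int[mu]_t (normc (g (expi t) - S n (expi t)) ^+ 2)%:E
    <= (tail n)%:E)%E.
  pose h k (t : T) := (normc (S (nu k) (expi t) - S n (expi t)) ^+ 2)%:E.
  have mh k : measurable_fun setT (h k).
    have [? ?] := L2_measurable (L2_B (S2 (nu k)) (S2 n)).
    apply/measurable_EFinP.
    exact: (@measurable_normc _ (fun z => S (nu k) z - S n z)).
  apply: (@le_trans _ _ (\int[mu]_t limn_einf (h ^~ t))%E).
    rewrite le_eqVlt; apply/orP; left; apply/eqP.
    apply: ge0_ae_eq_integral => //.
    - apply/measurable_EFinP.
      by apply: (@measurable_normc _ (fun z => g z - S n z));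
        [under eq_fun do rewrite cReD cReN|under eq_fun do rewrite cImD cImN];
        apply: measurable_funB => //; [exact: mRe|exact: mIm].
    - apply: measurableT_comp => //.
      by apply: measurable_fun_limn_esup => k; exact: measurableT_comp.
    - by move=> t _; rewrite lee_fin sqr_ge0.
    - move=> t _; rewrite limn_einf_lim.
      apply: lime_ge; first exact: is_cvg_einfs.
      apply: nearW => k; apply: le_ereal_inf_tmp => _ [m _ <-].
      by rewrite lee_fin sqr_ge0.
    have [N [mN N0 sN]] := cg; exists N; split => //.
    apply: subset_trans sN => t; apply: contra_not => ct _.
    suff /cvg_limn_einf_sup[-> _] : h ^~ t @ \oo -->
        (normc (g (expi t) - S n (expi t)) ^+ 2)%:E by [].
    have /ccvgP[cr ci] := ct.
    apply/fine_cvgP; split; first exact: nearW.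
    rewrite /h /comp; under eq_fun do rewrite /fine sqr_normcE.
    rewrite sqr_normcE.
    rewrite !(cReD, cImD, cReN, cImN).
    under eq_fun do rewrite !(cReD, cImD, cReN, cImN).
    by apply: cvgD; apply: cvgM; (apply: cvgB => //; exact: cvg_cst).
  apply: le_trans (fatou _ measurableT mh _) _.
    by move=> k t _; rewrite lee_fin sqr_ge0.
  rewrite limn_einf_lim; apply: lime_le; first exact: is_cvg_einfs.
  apply: nearW => k.
  apply: (@le_trans _ _ (\int[mu]_t h (maxn k n) t)%E).
    apply: ereal_inf_lbound; exists (maxn k n) => //=; exact: leq_maxl.
  rewrite (@circle_nrm2E _ (fun z => S (nu (maxn k n)) z - S n z));
    last exact: L2_B.
  rewrite lee_fin; apply: Scauchy.
  by rewrite (leq_trans _ (nu_ge _)) ?leq_maxr.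
have g2 : L2 g.
  have gS : L2 (fun z => g z - S 0%N z).
    apply: L2_intro.
    - under eq_fun do rewrite cReD cReN.
      by apply: measurable_funB => //; exact: mRe.
    - under eq_fun do rewrite cImD cImN.
      by apply: measurable_funB => //; exact: mIm.
    - by rewrite (le_lt_trans (fat 0%N)) ?ltry.
  have -> : g = (fun z => 1 * (g z - S 0%N z) + S 0%N z).
    by apply/funext => z; rewrite mul1r subrK.
  exact: L2_MD.
exists g => // n; rewrite -lee_fin -circle_nrm2E//; exact: L2_B.
Qed.

End Completeness.

Section ComplexLimits.
Context (R : realType).
Implicit Types (u v : nat -> R[i]) (l : R[i]).

Lemma ccvg_unique u l l' : ccvg u l -> ccvg u l' -> l = l'.
Proof.
move=> /ccvgP[ur ui] /ccvgP[ur' ui'].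
by apply: complex_ext; [exact: cvg_unique ur ur'|exact: cvg_unique ui ui'].
Qed.

Lemma ccvgMD (a : R[i]) u v l l' : ccvg u l -> ccvg v l' ->
  ccvg (fun n => a * u n + v n) (a * l + l').
Proof.
move=> /ccvgP[ur ui] /ccvgP[vr vi]; apply/ccvgP; split.
  under eq_fun do rewrite cReD cReM; rewrite cReD cReM.
  by apply: cvgD => //; apply: cvgB; (apply: cvgM => //; exact: cvg_cst).
under eq_fun do rewrite cImD cImM; rewrite cImD cImM.
by apply: cvgD => //; apply: cvgD; (apply: cvgM => //; exact: cvg_cst).
Qed.

Lemma ccvgJ u l : ccvg u l -> ccvg (fun n => conjc (u n)) (conjc l).
Proof.
move=> /ccvgP[ur ui]; apply/ccvgP; split.
  by under eq_fun do rewrite cReJ; rewrite cReJ.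
by under eq_fun do rewrite cImJ; rewrite cImJ; exact: cvgN.
Qed.

Lemma ccvg_near u l : (\forall n \near \oo, u n = l) -> ccvg u l.
Proof.
move=> ul; apply/ccvgP; split; apply: cvg_near_cst;
  by apply: filterS ul => n ->.
Qed.

(** The involution [swap] permutes the first n indices only when n is even, so
    series are reordered through their partial sums of even length. *)
Lemma ccvg_double u l : ccvg u l -> ccvg (fun n => u n.*2) l.
Proof.
move=> ul; apply: (cvg_comp (fun n => n.*2) (fun n => normc (u n - l)) _ ul).
by move=> A [N _ NA]; exists N => // n /= Nn; apply: NA => /=; lia.
Qed.

Lemma ccvg_sqr u l (v : nat -> R) : (forall n, normc (u n - l) ^+ 2 <= v n) ->
  v @ \oo --> 0 -> ccvg u l.
Proof.
move=> uv v0; apply: (@squeeze_cvgr _ _ _ _ (cst 0) (fun n => Num.sqrt (v n))).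
- apply: nearW => n; rewrite normc_ge0/=.
  rewrite -[normc _]ger0_norm ?normc_ge0// -sqrtr_sqr ler_wsqrtr//.
- exact: cvg_cst.
- have := @sqrt_continuous R 0; rewrite /continuous_at sqrtr0.
  exact: cvg_comp.
Qed.

Lemma sum_swap_doubleC u n :
  \sum_(0 <= k < n.*2) u (swap k) = \sum_(0 <= k < n.*2) u k.
Proof.
elim: n => [|n IHn]; first by rewrite !big_nil.
rewrite doubleS !big_nat_recr//= IHn /swap /= odd_double /=.
by rewrite -!addrA [u _.+1 + _]addrC.
Qed.

End ComplexLimits.

(** * Trigonometric polynomials *)

Section TrigPoly.
Context (R : realType).
Local Notation L2 := (@circle_Lp R 2%:E).
Implicit Types (f g h : R[i] -> R[i]) (a : nat -> R[i]) (r : seq nat).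

Definition trig_poly r a : R[i] -> R[i] := fun z => \sum_(k <- r) a k * z ^+ k.

Lemma trig_poly_cons k r a :
  trig_poly (k :: r) a = (fun z => a k * z ^+ k + trig_poly r a z).
Proof. by apply/funext => z; rewrite /trig_poly big_cons. Qed.

Lemma L2_trig_poly r a : L2 (trig_poly r a).
Proof.
elim: r => [|k r IHr].
  have -> : trig_poly [::] a = (fun z => -1 * z ^+ 0 + z ^+ 0).
    by apply/funext => z; rewrite /trig_poly big_nil mulN1r addNr.
  by apply: L2_MD; exact: L2_monomial.
by rewrite trig_poly_cons; apply: L2_MD => //; exact: L2_monomial.
Qed.

Lemma L2_ip_trig_polyl r a h : L2 h ->
  L2_ip (trig_poly r a) h = \sum_(k <- r) a k * L2_ip (fun z => z ^+ k) h.
Proof.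
move=> h2; elim: r => [|k r IHr].
  rewrite big_nil; apply: complex_ext; rewrite /=
    -[RHS](mul0r (fine (@circle_measure R setT))) -Rintegral_cst//;
    by apply: eq_Rintegral => t _; rewrite /trig_poly big_nil mul0r.
rewrite trig_poly_cons L2_ipMDl ?IHr ?big_cons//; first exact: L2_monomial.
exact: L2_trig_poly.
Qed.

Lemma L2_ip_trig_polyr r a h : L2 h ->
  L2_ip h (trig_poly r a) =
  \sum_(k <- r) conjc (a k) * L2_ip h (fun z => z ^+ k).
Proof.
move=> h2; rewrite L2_ipC//; last exact: L2_trig_poly.
rewrite L2_ip_trig_polyl// (rmorph_sum (@conjc R)); apply: eq_bigr => k _.
rewrite [LHS]conjcM; congr (_ * _); rewrite -L2_ipC//; exact: L2_monomial.
Qed.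

Lemma L2_ip_trig_poly_monomial r a k : uniq r -> k \in r ->
  L2_ip (trig_poly r a) (fun z => z ^+ k) = a k.
Proof.
move=> ur kr; rewrite L2_ip_trig_polyl; last exact: L2_monomial.
rewrite (bigD1_seq k)//= L2_ip_monomial eqxx mulr1 big1 ?addr0// => j jk.
by rewrite L2_ip_monomial (negbTE jk) mulr0.
Qed.

Lemma circle_nrm2_trig_poly r a : uniq r ->
  circle_nrm2 (trig_poly r a) = \sum_(k <- r) normc (a k) ^+ 2.
Proof.
move=> ur; apply: (@complexI R); rewrite -L2_ipxx.
rewrite L2_ip_trig_polyr; last exact: L2_trig_poly.
rewrite rmorph_sum /= !big_seq; apply: eq_bigr => k kr.
rewrite L2_ip_trig_poly_monomial// sqr_normcE.
by case: (a k) => x y; apply: complex_ext => /=; ring.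
Qed.

(** The squared distance from g to its projection on the span of the first n
    monomials is nonnegative. *)
Lemma Bessel g n : L2 g ->
  \sum_(0 <= k < n) normc (L2_ip g (fun z => z ^+ k)) ^+ 2 <= circle_nrm2 g.
Proof.
move=> g2; set a := fun k => L2_ip g (fun z => z ^+ k).
set r := index_iota 0 n; have ur : uniq r by exact: iota_uniq.
have p2 := L2_trig_poly r a.
have := circle_nrm2_ge0 (fun z => -1 * trig_poly r a z + g z).
suff -> : circle_nrm2 (fun z => -1 * trig_poly r a z + g z) =
    circle_nrm2 g - \sum_(k <- r) normc (a k) ^+ 2 by rewrite subr_ge0.
have gp : L2_ip g (trig_poly r a) = (\sum_(k <- r) normc (a k) ^+ 2)%:C.
  rewrite L2_ip_trig_polyr// rmorph_sum; apply: eq_bigr => k _.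
  rewrite -/(a k) sqr_normcE.
  by case: (a k) => x y; apply: complex_ext => /=; ring.
apply: (@complexI R); rewrite -L2_ipxx.
rewrite L2_ipMDr//; last exact: L2_MD.
rewrite !L2_ipMDl// !L2_ipxx gp [L2_ip _ g]L2_ipC// gp circle_nrm2_trig_poly//.
by apply: complex_ext => /=; ring.
Qed.

Lemma L2_ip_cvg (S : nat -> R[i] -> R[i]) g h :
  (forall n, L2 (S n)) -> L2 g -> L2 h ->
  (fun n => circle_nrm2 (fun z => S n z - g z)) @ \oo --> 0 ->
  ccvg (fun n => L2_ip (S n) h) (L2_ip g h).
Proof.
move=> S2 g2 h2 Sg.
apply: (@ccvg_sqr _ _ _
  (fun n => circle_nrm2 (fun z => S n z - g z) * circle_nrm2 h)).
  move=> n; have -> : L2_ip (S n) h - L2_ip g h =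
      L2_ip (fun z => S n z - g z) h.
    have -> : (fun z => S n z - g z) = (fun z => -1 * g z + S n z).
      by apply/funext => z; rewrite mulN1r addrC.
    by rewrite L2_ipMDl// mulN1r addrC.
  by apply: L2_Cauchy_Schwarz => //; exact: L2_B.
rewrite -[X in _ --> X](mul0r (circle_nrm2 h)).
by apply: cvgM => //; exact: cvg_cst.
Qed.

End TrigPoly.

(** * The Hardy space inside L2 *)

Section HardySpace.
Context (R : realType).
Local Notation L2 := (@circle_Lp R 2%:E).
Local Notation hardy := (hardy R).
Implicit Types (f g : hardy) (h phi psi : R[i] -> R[i]).

(** The Taylor polynomials form a Cauchy sequence in L2, since their distances
    are blocks of the convergent series of squared coefficients; completeness
    makes the choice in the definition of [boundary] meaningful. *)
Lemma boundary_spec f : L2 (boundary f) /\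
  (fun n => circle_nrm2 (fun z =>
     trig_poly (index_iota 0 n) f z - boundary f z)) @ \oo --> 0.
Proof.
pose S n := trig_poly (index_iota 0 n) f.
have S2 n : L2 (S n) by exact: L2_trig_poly.
pose u n := normc (f n : R[i]) ^+ 2.
have cf : cvgn (series u) by exact/square_summableP/coefP.
pose tail n := limn (series u) - series u n.
have tail0 : tail @ \oo --> 0.
  by rewrite -(subrr (limn (series u))); apply: cvgB => //; exact: cvg_cst.
have nrmC h1 h2 : circle_nrm2 (fun z => h1 z - h2 z) =
    circle_nrm2 (fun z => h2 z - h1 z).
  apply: eq_Rintegral => t _; rewrite -opprB.
  by rewrite !sqr_normcE cReN cImN !sqrrN.
have Scauchy m n : (n <= m)%N ->
    circle_nrm2 (fun z => S m z - S n z) <= tail n.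
  move=> nm; have -> : (fun z => S m z - S n z) = trig_poly (index_iota n m) f.
    apply/funext => z; rewrite /S /trig_poly (big_cat_nat (n := n))//=.
    by rewrite addrAC subrr add0r.
  rewrite circle_nrm2_trig_poly; last exact: iota_uniq.
  rewrite lerBrDl -/u /series /= -(big_cat_nat (n := n))//=.
  apply: (nondecreasing_cvgn_le _ cf).
  by apply: nondecreasing_series => k _ _; exact: sqr_ge0.
have [g0 g02 g0S] := L2_complete S2 tail0 Scauchy.
have SE n : (fun z => \sum_(k < n) (f k : R[i]) * z ^+ k) = S n.
  by apply/funext => z; rewrite /S /trig_poly big_mkord.
pose P := [set g | L2 g /\
  L2_cvg (fun n z => \sum_(k < n) (f k : R[i]) * z ^+ k) g].
have PE h : L2 h ->
    (fun n => \int[circle_measure R]_t (normc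
      (\sum_(k < n) (f k : R[i]) * expi t ^+ k - h (expi t)) ^+ 2)%:E)%E =
    (fun n => (circle_nrm2 (fun z => S n z - h z))%:E).
  move=> h2; apply/funext => n; rewrite -circle_nrm2E; last exact: L2_B.
  by apply: eq_integral => t _; rewrite -SE.
have [b2 bS] : P (boundary f).
  apply: xgetPex; exists g0; split=> //; rewrite /L2_cvg PE//.
  apply/fine_cvgP; split; first exact: nearW.
  apply: (@squeeze_cvgr _ _ _ _ (cst 0) tail) => //; last exact: cvg_cst.
  by apply: nearW => n; rewrite /= circle_nrm2_ge0 nrmC g0S.
by split=> //; move: bS; rewrite /L2_cvg PE// => /fine_cvgP[].
Qed.

Lemma L2_boundary f : L2 (boundary f).
Proof. by have [] := boundary_spec f. Qed.

Lemma boundary_expansion f h : L2 h ->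
  ccvg (fun n => \sum_(0 <= k < n) (f k : R[i]) * L2_ip (fun z => z ^+ k) h)
    (L2_ip (boundary f) h).
Proof.
move=> h2; have [b2 bS] := boundary_spec f.
have -> : (fun n =>
      \sum_(0 <= k < n) (f k : R[i]) * L2_ip (fun z => z ^+ k) h) =
    (fun n => L2_ip (trig_poly (index_iota 0 n) f) h).
  by apply/funext => n; rewrite L2_ip_trig_polyl.
by apply: L2_ip_cvg => // n; exact: L2_trig_poly.
Qed.

Lemma boundary_coef f k : L2_ip (boundary f) (fun z => z ^+ k) = f k.
Proof.
apply: ccvg_unique (boundary_expansion f (L2_monomial R k)) _.
apply: ccvg_near; exists k.+1 => // n /= kn.
rewrite -L2_ip_trig_polyl; last exact: L2_monomial.
by rewrite L2_ip_trig_poly_monomial ?iota_uniq// mem_index_iota.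
Qed.

Lemma hardy_ip_cvg f g :
  ccvg (fun n => \sum_(0 <= k < n) (f k : R[i]) * conjc (g k : R[i]))
    (L2_ip (boundary f) (boundary g)).
Proof.
have := boundary_expansion f (L2_boundary g).
have -> // : (fun n => \sum_(0 <= k < n) (f k : R[i]) * conjc (g k : R[i])) =
    (fun n => \sum_(0 <= k < n)
       (f k : R[i]) * L2_ip (fun z => z ^+ k) (boundary g)).
apply/funext => n; apply: eq_bigr => k _; congr (_ * _).
rewrite L2_ipC ?boundary_coef//; [exact: L2_monomial|exact: L2_boundary].
Qed.

(** This moves the inner product of the coefficient space into L2, where
    multiplication by a bounded symbol makes sense. *)
Lemma Parseval f g : hardy_ip f g = L2_ip (boundary f) (boundary g).
Proof.
have sumRe (u : nat -> R[i]) n :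
    Re (\sum_(0 <= k < n) u k) = series (fun k => Re (u k)) n.
  by rewrite /series /=; elim/big_rec2: _ => // k x y _ <-; rewrite cReD.
have sumIm (u : nat -> R[i]) n :
    Im (\sum_(0 <= k < n) u k) = series (fun k => Im (u k)) n.
  by rewrite /series /=; elim/big_rec2: _ => // k x y _ <-; rewrite cImD.
have /ccvgP[cr ci] := hardy_ip_cvg f g.
apply: complex_ext; rewrite /hardy_ip [LHS]/=.
  apply: cvg_lim => //; move: cr.
  by under eq_fun do rewrite sumRe.
apply: cvg_lim => //; move: ci.
by under eq_fun do rewrite sumIm.
Qed.

(** The Fourier coefficients of h with nonnegative index are square summable by
    Bessel's inequality, and the function they define is a projection of h. *)
Lemma hardy_proj_spec h g : L2 h ->
  hardy_ip (hardy_proj h) g = L2_ip h (boundary g).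
Proof.
move=> h2; pose a n : R[i]^o := L2_ip h (fun z => z ^+ n).
have a2 : a \in @square_summable R.
  apply/square_summableP; apply: nondecreasing_is_cvgn.
    by apply: nondecreasing_series => k _ _; exact: sqr_ge0.
  by exists (circle_nrm2 h) => _ [n _ <-]; exact: Bessel.
pose P := [set p : hardy | forall k : hardy,
    L2_ip (fun z => h z - boundary p z) (boundary k) = 0].
have Pproj : P (hardy_proj h).
  apply: xgetPex; exists (Hardy a2) => k.
  have w2 : L2 (fun z => h z - boundary (Hardy a2) z).
    by apply: L2_B => //; exact: L2_boundary.
  rewrite L2_ipC//; last exact: L2_boundary.
  rewrite -[RHS](@conjc0 R); congr (conjc _).
  apply: ccvg_unique (boundary_expansion k w2) _; apply: ccvg_near.
  apply: nearW => n; apply: big1 => j _.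
  have -> : L2_ip (fun z => z ^+ j) (fun z => h z - boundary (Hardy a2) z) = 0.
    rewrite L2_ipC//; last exact: L2_monomial.
    rewrite -[RHS](@conjc0 R); congr (conjc _).
    have -> : (fun z => h z - boundary (Hardy a2) z) =
        (fun z => -1 * boundary (Hardy a2) z + h z).
      by apply/funext => z; rewrite mulN1r addrC.
    rewrite L2_ipMDl//; [|exact: L2_boundary|exact: L2_monomial].
    by rewrite boundary_coef mulN1r addNr.
  by rewrite mulr0.
rewrite Parseval.
have b2 := L2_boundary (hardy_proj h); have bg2 := L2_boundary g.
have := Pproj g; rewrite -[X in L2_ip X _ = _](_ : (fun z =>
    -1 * boundary (hardy_proj h) z + h z) = _); last first.
  by apply/funext => z; rewrite mulN1r addrC.
by rewrite L2_ipMDl// mulN1r addrC => /subr0_eq.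
Qed.

(** The sesquilinear form <T_phi f, g>, without the projection: the part of
    phi f that it removes is orthogonal to g. *)
Definition toeplitz_form phi f g : R[i] :=
  L2_ip (fun z => phi z * boundary f z) (boundary g).

Lemma toeplitz_formE phi f g : circle_Lp +oo%E phi ->
  hardy_ip (toeplitz phi f) g = toeplitz_form phi f g.
Proof.
move=> phioo; apply: hardy_proj_spec.
by apply: Linf_mul => //; exact: L2_boundary.
Qed.

Lemma LinfJ phi : circle_Lp +oo%E phi ->
  circle_Lp +oo%E (fun z => conjc (phi z)).
Proof.
move=> [pr pi]; split; first by under eq_fun do rewrite cReJ.
under eq_fun do rewrite cImJ.
exact: (@Lfun_oppr_closed _ _ _ (circle_measure R) _ _ pi).
Qed.

Lemma L2_ip_mulJ phi h1 h2 :
  L2_ip (fun z => phi z * h1 z) h2 = L2_ip h1 (fun z => conjc (phi z) * h2 z).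
Proof.
apply: eq_circle_integral => t.
by rewrite conjcM conjcK mulrCA mulrA.
Qed.

(** A Toeplitz form is determined by the Fourier coefficients of its symbol
    through iterated series, with the f-variable outside here and inside in
    [toeplitz_form_right]. Moving the symbol to the other side of the inner
    product reduces both to the expansion of a boundary function. *)
Lemma toeplitz_form_left phi f g : circle_Lp +oo%E phi ->
  ccvg (fun n => \sum_(0 <= j < n) (f j : R[i]) *
          L2_ip (fun z => phi z * z ^+ j) (boundary g))
    (toeplitz_form phi f g).
Proof.
move=> phioo; rewrite /toeplitz_form L2_ip_mulJ.
have := @boundary_expansion f (fun z => conjc (phi z) * boundary g z) _.
under [X in _ -> ccvg X _]eq_fun do under eq_bigr do rewrite L2_ip_mulJ.
by apply; apply: Linf_mul; [exact: LinfJ|exact: L2_boundary].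
Qed.

Lemma L2_ip_boundaryr g h : L2 h ->
  ccvg (fun n => \sum_(0 <= k < n)
          conjc (g k : R[i]) * L2_ip h (fun z => z ^+ k))
    (L2_ip h (boundary g)).
Proof.
move=> h2; rewrite L2_ipC//; last exact: L2_boundary.
have := ccvgJ (boundary_expansion g h2).
have -> // : (fun n => conjc
      (\sum_(0 <= k < n) (g k : R[i]) * L2_ip (fun z => z ^+ k) h)) =
    (fun n => \sum_(0 <= k < n)
       conjc (g k : R[i]) * L2_ip h (fun z => z ^+ k)).
apply/funext => n; rewrite (rmorph_sum (@conjc R)); apply: eq_bigr => k _.
by rewrite [LHS]conjcM; congr (_ * _); rewrite -L2_ipC//; exact: L2_monomial.
Qed.

Lemma toeplitz_form_right phi f g : circle_Lp +oo%E phi ->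
  ccvg (fun n => \sum_(0 <= k < n) conjc (g k : R[i]) *
          L2_ip (fun z => phi z * boundary f z) (fun z => z ^+ k))
    (toeplitz_form phi f g).
Proof.
move=> phioo; apply: L2_ip_boundaryr.
by apply: Linf_mul => //; exact: L2_boundary.
Qed.

Lemma toeplitz_col phi j g : circle_Lp +oo%E phi ->
  ccvg (fun n => \sum_(0 <= k < n) conjc (g k : R[i]) *
          fourier phi (k%:Z - j%:Z))
    (L2_ip (fun z => phi z * z ^+ j) (boundary g)).
Proof.
move=> phioo; under eq_fun do under eq_bigr do rewrite -fourierE.
by apply: L2_ip_boundaryr; apply: Linf_mul => //; exact: L2_monomial.
Qed.

Lemma toeplitz_row phi f k : circle_Lp +oo%E phi ->
  ccvg (fun n => \sum_(0 <= j < n) (f j : R[i]) * fourier phi (k%:Z - j%:Z))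
    (L2_ip (fun z => phi z * boundary f z) (fun z => z ^+ k)).
Proof.
move=> phioo; rewrite L2_ip_mulJ.
under eq_fun do under eq_bigr do rewrite -fourierE L2_ip_mulJ.
apply: boundary_expansion; apply: Linf_mul; first exact: LinfJ.
exact: L2_monomial.
Qed.

End HardySpace.

(** * Dependence of Toeplitz forms on the symbol *)

Section Symbols.
Context (R : realType).
Local Notation L2 := (@circle_Lp R 2%:E).
Local Notation Loo := (@circle_Lp R +oo%E).
Local Notation hardy := (hardy R).
Implicit Types (f g : hardy) (phi psi : R[i] -> R[i]).

Lemma LinfD phi psi : Loo phi -> Loo psi -> Loo (phi \+ psi).
Proof.
have p1 : (1 <= +oo :> \bar R)%E by exact: leey.
have [_ D] := @Lfun_addr_closed _ _ _ (circle_measure R) _ p1.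
move=> [pr pi] [qr qi]; split.
  by under eq_fun do rewrite cReD; exact: D pr qr.
by under eq_fun do rewrite cImD; exact: D pi qi.
Qed.

Lemma LinfB phi psi : Loo phi -> Loo psi -> Loo (phi \- psi).
Proof.
move=> poo [qr qi]; apply: LinfD => //; split.
  under eq_fun do rewrite cReN.
  exact: (@Lfun_oppr_closed _ _ _ (circle_measure R) _ _ qr).
under eq_fun do rewrite cImN.
exact: (@Lfun_oppr_closed _ _ _ (circle_measure R) _ _ qi).
Qed.

Lemma L2_ip_symbolD phi psi h1 h2 : Loo phi -> Loo psi -> L2 h1 -> L2 h2 ->
  L2_ip (fun z => (phi \+ psi) z * h1 z) h2 =
  L2_ip (fun z => phi z * h1 z) h2 + L2_ip (fun z => psi z * h1 z) h2.
Proof.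
move=> poo qoo h12 h22; rewrite -[X in X + _]mul1r -L2_ipMDl//.
- by apply: eq_circle_integral => t; rewrite mul1r mulrDl.
- exact: Linf_mul.
- exact: Linf_mul.
Qed.

Lemma L2_ip_symbolB phi psi h1 h2 : Loo phi -> Loo psi -> L2 h1 -> L2 h2 ->
  L2_ip (fun z => (phi \- psi) z * h1 z) h2 =
  L2_ip (fun z => phi z * h1 z) h2 - L2_ip (fun z => psi z * h1 z) h2.
Proof.
move=> poo qoo h12 h22; rewrite addrC -mulN1r -L2_ipMDl//.
- by apply: eq_circle_integral => t; rewrite mulN1r addrC mulrBl.
- exact: Linf_mul.
- exact: Linf_mul.
Qed.

(** Every Fourier coefficient is a matrix entry, including those of negative
    index; so the linearity of matrix entries in the symbol passes to them. *)
Lemma fourier_ip (k : int) : exists p q : nat,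
  forall phi,
    fourier phi k = L2_ip (fun z : R[i] => phi z * z ^+ p) (fun z => z ^+ q).
Proof.
case: k => n.
  by exists 0%N, n => psi; rewrite fourierE subr0.
by exists n.+1, 0%N => psi; rewrite fourierE sub0r NegzE.
Qed.

Lemma fourierD phi psi k : Loo phi -> Loo psi ->
  fourier (phi \+ psi) k = fourier phi k + fourier psi k.
Proof.
move=> poo qoo; have [p [q E]] := fourier_ip k.
by rewrite !E L2_ip_symbolD//; exact: L2_monomial.
Qed.

Lemma fourierB phi psi k : Loo phi -> Loo psi ->
  fourier (phi \- psi) k = fourier phi k - fourier psi k.
Proof.
move=> poo qoo; have [p [q E]] := fourier_ip k.
by rewrite !E L2_ip_symbolB//; exact: L2_monomial.
Qed.

Lemma toeplitz_form_symbolD phi psi f g : Loo phi -> Loo psi ->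
  toeplitz_form (phi \+ psi) f g =
  toeplitz_form phi f g + toeplitz_form psi f g.
Proof. by move=> poo qoo; apply: L2_ip_symbolD => //; exact: L2_boundary. Qed.

Lemma toeplitz_form_symbolB phi psi f g : Loo phi -> Loo psi ->
  toeplitz_form (phi \- psi) f g =
  toeplitz_form phi f g - toeplitz_form psi f g.
Proof. by move=> poo qoo; apply: L2_ip_symbolB => //; exact: L2_boundary. Qed.

(** The Riemann-Lebesgue lemma in the direction of positive indices: by Bessel's
    inequality the coefficients are square summable. *)
Lemma fourier_cvg0 phi : Loo phi -> ccvg (fun n : nat => fourier phi n%:Z) 0.
Proof.
move=> poo.
have p2 : L2 (fun z => phi z * z ^+ 0) := Linf_mul poo (L2_monomial R 0).
apply: (@ccvg_sqr _ _ _ (fun n => normc (fourier phi n%:Z) ^+ 2)).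
  by move=> n; rewrite subr0.
apply: cvg_series_cvg_0; apply: nondecreasing_is_cvgn.
  by apply: nondecreasing_series => k _ _; exact: sqr_ge0.
exists (circle_nrm2 (fun z => phi z * z ^+ 0)) => _ [n _ <-].
rewrite /series /=.
apply: le_trans (Bessel n p2).
by apply: ler_sum => k _; rewrite fourierE subr0.
Qed.

(** A coefficient repeated along an arithmetic progression is a limit value of
    a sequence tending to 0. *)
Lemma fourier_periodic0 phi (k : int) (d : nat) : Loo phi -> (0 < d)%N ->
  (forall m : nat, fourier phi (k + (d * m)%N%:Z) = fourier phi k) ->
  fourier phi k = 0.
Proof.
move=> poo d0 per; apply: ComplexField.Normc.eq0_normc; apply/eqP.
rewrite eq_le normc_ge0 andbT; apply/ler_addgt0Pr => e e0; rewrite add0r.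
have /cvgrPdist_le /(_ e e0)[N _ NP] := fourier_cvg0 poo.
have [n [m [Nn nE]]] : exists n m : nat, (N <= n)%N /\ n%:Z = k + (d * m)%N%:Z.
  by exists (absz (k + (d * (N + absz k))%N%:Z)), (N + absz k)%N; nia.
have fn : fourier phi n%:Z = fourier phi k by rewrite nE; exact: per.
have : `|0 - normc (fourier phi n%:Z - 0)| <= e := NP n Nn.
rewrite fn subr0 sub0r normrN.
by rewrite ger0_norm ?normc_ge0.
Qed.

Lemma toeplitz_formMDl phi (a : R[i]) f f' g : Loo phi ->
  toeplitz_form phi (a *: f + f') g =
  a * toeplitz_form phi f g + toeplitz_form phi f' g.
Proof.
move=> poo; apply: ccvg_unique (toeplitz_form_left _ _ poo) _.
have := ccvgMD a (toeplitz_form_left f g poo) (toeplitz_form_left f' g poo).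
under [X in ccvg X _ -> _]eq_fun do rewrite big_distrr -big_split.
under [X in _ -> ccvg X _]eq_fun do under eq_bigr => k _ do
  rewrite -[((a *: f + f') k : R[i])]/(a * f k + f' k) mulrDl -mulrA.
by [].
Qed.

Lemma toeplitz_formMDr phi (a : R[i]) f g g' : Loo phi ->
  toeplitz_form phi f (a *: g + g') =
  conjc a * toeplitz_form phi f g + toeplitz_form phi f g'.
Proof.
move=> poo; apply: ccvg_unique (toeplitz_form_right _ _ poo) _.
have := ccvgMD (conjc a) (toeplitz_form_right f g poo)
  (toeplitz_form_right f g' poo).
under [X in ccvg X _ -> _]eq_fun do rewrite big_distrr -big_split.
under [X in _ -> ccvg X _]eq_fun do under eq_bigr => k _ do
  rewrite -[((a *: g + g') k : R[i])]/(a * g k + g' k) conjcD conjcM mulrDl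
    -mulrA.
by [].
Qed.

End Symbols.

(** * Toeplitz operators and the conjugation C_2 *)

Section Swap.
Context (R : realType).
Local Notation L2 := (@circle_Lp R 2%:E).
Local Notation Loo := (@circle_Lp R +oo%E).
Local Notation hardy := (hardy R).
Implicit Types (f g : hardy) (phi psi : R[i] -> R[i]).

Lemma swap_coef f k : (swap_conj f k : R[i]) = conjc (f (swap k) : R[i]).
Proof. by []. Qed.

(** If F is the form of an operator T, this is the form of C_2 T^* C_2, because
    C_2 is antiunitary. *)
Definition conj_form (F : hardy -> hardy -> R[i]) f g : R[i] :=
  F (swap_conj g) (swap_conj f).

Lemma ccvg_swap (u : nat -> R[i]) l :
  ccvg (fun n => \sum_(0 <= k < n) u (swap k)) l ->
  ccvg (fun n => \sum_(0 <= k < n.*2) u k) l.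
Proof.
by move/ccvg_double; under eq_fun do rewrite sum_swap_doubleC.
Qed.

(** Both forms have the same matrix. The left one is expanded with f outside;
    in the right one f is the second argument, so the other expansion
    also has f outside, and no exchange of limits is needed. Conjugation by C_2
    only reindexes the sums by [swap]. *)
Lemma toeplitz_form_swap phi psi : Loo phi -> Loo psi ->
  (forall j k : nat, fourier phi (k%:Z - j%:Z) =
                     fourier psi ((swap j)%:Z - (swap k)%:Z)) ->
  forall f g, toeplitz_form phi f g = conj_form (toeplitz_form psi) f g.
Proof.
move=> poo qoo pq f g.
apply: ccvg_unique (ccvg_double (toeplitz_form_left f g poo)) _.
pose row k :=
  L2_ip (fun z => psi z * boundary (swap_conj g) z) (fun z => z ^+ k).
have colE j : L2_ip (fun z => phi z * z ^+ j) (boundary g) = row (swap j).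
  apply: ccvg_unique (ccvg_double (toeplitz_col j g poo)) _.
  have := @ccvg_swap (fun k => conjc (g k : R[i]) *
    fourier psi ((swap j)%:Z - (swap k)%:Z)) (row (swap j)).
  under [X in _ -> ccvg X _]eq_fun do under eq_bigr do rewrite pq.
  apply; under eq_fun do under eq_bigr do rewrite swapK.
  exact: (toeplitz_row (swap_conj g)).
under eq_fun do under eq_bigr do rewrite colE.
apply: (@ccvg_swap (fun j => (f j : R[i]) * row (swap j))).
have := toeplitz_form_right (swap_conj g) (swap_conj f) qoo.
under eq_fun do under eq_bigr do rewrite swap_coef conjcK.
by under [X in _ -> ccvg X _]eq_fun do under eq_bigr do rewrite swapK.
Qed.

Lemma monomial_summable j :
  (fun n => ((n == j)%:R : R[i]^o)) \in @square_summable R.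
Proof.
apply/square_summableP; apply/cvg_ex; exists 1; apply: cvg_near_cst.
exists j.+1 => // n /= jn; rewrite /series /=.
rewrite (bigD1_seq j) ?iota_uniq ?mem_index_iota//= eqxx big1 ?addr0.
  by rewrite ComplexField.Normc.normc1 expr1n.
by move=> k /negbTE ->; rewrite ComplexField.Normc.normc0 expr0n.
Qed.

Definition hardy_monomial j : hardy := Hardy (monomial_summable j).

Lemma swap_conj_monomial j :
  swap_conj (hardy_monomial j) = hardy_monomial (swap j).
Proof.
apply: val_inj; apply/funext => n /=.
rewrite (inv_eq swapK) eq_sym [swap j == n]eq_sym.
by case: (n == _); rewrite ?conjc1 ?conjc0 // eq_sym.
Qed.

Lemma sum_monomial (u : nat -> R[i]) j :
  ccvg (fun n => \sum_(0 <= k < n) (hardy_monomial j k : R[i]) * u k) (u j).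
Proof.
apply: ccvg_near; exists j.+1 => // n /= jn.
rewrite (bigD1_seq j) ?iota_uniq ?mem_index_iota//= eqxx mul1r big1 ?addr0//.
by move=> k /negbTE ->; rewrite mul0r.
Qed.

Lemma toeplitz_form_monomial phi j k : Loo phi ->
  toeplitz_form phi (hardy_monomial j) (hardy_monomial k) =
  fourier phi (k%:Z - j%:Z).
Proof.
move=> poo.
rewrite (ccvg_unique (toeplitz_form_left _ _ poo) (@sum_monomial
  (fun i => L2_ip (fun z => phi z * z ^+ i) (boundary (hardy_monomial k))) j)).
apply: ccvg_unique (toeplitz_col j _ poo) _.
have realE i : conjc (hardy_monomial k i : R[i]) = hardy_monomial k i.
  by rewrite /=; case: eqP => _; rewrite ?conjc1 ?conjc0.
under eq_fun do under eq_bigr do rewrite realE.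
exact: (@sum_monomial (fun i => fourier phi (i%:Z - j%:Z)) k).
Qed.

Lemma swap_double n : swap n.*2 = n.*2.+1.
Proof. by rewrite /swap odd_double. Qed.

Lemma swap_doubleS n : swap n.*2.+1 = n.*2.
Proof. by rewrite /swap /= odd_double. Qed.

(** Comparing entries, the condition says that the coefficient of phi at k - j
    is that of psi at swap j - swap k. For j and k of the same parity,
    swap j - swap k = - (k - j), which is the first equation. For opposite
    parities the shift of the indices goes one way or the other, according to
    which of j and k is even: the coefficient of phi at 2 l + 1 is equal
    both to that of psi at 1 - 2 l and to that at - 2 l - 3. Hence the odd
    coefficients are periodic of period 4, so they vanish by
    Riemann-Lebesgue. *)
Lemma toeplitz_form_swapP phi psi : Loo phi -> Loo psi ->
  (forall f g, toeplitz_form phi f g = conj_form (toeplitz_form psi) f g) <->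
  forall l : int, [/\ fourier phi (2 * l) = fourier psi (- (2 * l)),
    fourier phi (2 * l + 1) = 0 & fourier psi (2 * l + 1) = 0].
Proof.
move=> poo qoo; split=> [pq|pq]; last first.
  apply: toeplitz_form_swap => // j k.
  have parity n : exists m, n = m.*2 \/ n = m.*2.+1.
    by exists n./2; case: (boolP (odd n)) => n2; [right|left]; lia.
  have [[a aE] [b bE]] := (parity j, parity k).
  have [even _ _] := pq (b%:Z - a%:Z).
  case: aE bE => -> [] ->; rewrite ?swap_double ?swap_doubleS.
  - rewrite (_ : _ - _ = 2 * (b%:Z - a%:Z)); last by lia.
    by rewrite even; congr (fourier _ _); lia.
  - have [_ + _] := pq (b%:Z - a%:Z); have [_ _ +] := pq (a%:Z - b%:Z).
    rewrite (_ : 2 * (a%:Z - b%:Z) + 1 = a.*2.+1%:Z - b.*2%:Z); last by lia.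
    rewrite (_ : 2 * (b%:Z - a%:Z) + 1 = b.*2.+1%:Z - a.*2%:Z); last by lia.
    by move=> -> ->.
  - have [_ + _] := pq (b%:Z - a%:Z - 1); have [_ _ +] := pq (a%:Z - b%:Z - 1).
    rewrite (_ : 2 * (a%:Z - b%:Z - 1) + 1 = a.*2%:Z - b.*2.+1%:Z); last by lia.
    rewrite (_ : 2 * (b%:Z - a%:Z - 1) + 1 = b.*2%:Z - a.*2.+1%:Z); last by lia.
    by move=> -> ->.
  - rewrite (_ : _ - _ = 2 * (b%:Z - a%:Z)); last by lia.
    by rewrite even; congr (fourier _ _); lia.
have {}pq j k :
    fourier phi (k%:Z - j%:Z) = fourier psi ((swap j)%:Z - (swap k)%:Z).
  rewrite -(toeplitz_form_monomial j k poo) pq /conj_form.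
  rewrite !swap_conj_monomial.
  exact: toeplitz_form_monomial.
(* Every integer is a difference of two row indices, as the matrix only has
   nonnegative ones. *)
have diff (l : int) : exists a b : nat, l = b%:Z - a%:Z.
  by case: l => n; [exists 0%N, n|exists n.+1, 0%N]; lia.
have even l : fourier phi (2 * l) = fourier psi (- (2 * l)).
  have [a [b lE]] := diff l; have := pq a.*2 b.*2; rewrite !swap_double.
  rewrite (_ : b.*2%:Z - _ = 2 * l); last by lia.
  by move=> ->; congr (fourier _ _); lia.
have odd1 l : fourier phi (2 * l + 1) = fourier psi (1 - 2 * l).
  have [a [b lE]] := diff l; have := pq a.*2 b.*2.+1.
  rewrite swap_double swap_doubleS.
  rewrite (_ : b.*2.+1%:Z - _ = 2 * l + 1); last by lia.
  by move=> ->; congr (fourier _ _); lia.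
have odd2 l : fourier phi (2 * l + 1) = fourier psi (- (2 * l) - 3).
  have [a [b lE]] := diff (l + 1); have := pq a.*2.+1 b.*2.
  rewrite swap_double swap_doubleS (_ : b.*2%:Z - _ = 2 * l + 1); last by lia.
  by move=> ->; congr (fourier _ _); lia.
move=> l; split => //; apply: (@fourier_periodic0 _ _ _ 4) => // m.
  elim: m => [|m IHm]; first by rewrite muln0 addr0.
  rewrite -IHm.
  rewrite (_ : 2 * l + 1 + (4 * m.+1)%N%:Z = 2 * (l + (2 * m.+1)%N%:Z) + 1).
    rewrite odd1 (_ : 2 * l + 1 + (4 * m)%N%:Z = 2 * (l + (2 * m)%N%:Z) + 1).
      by rewrite odd2; congr (fourier _ _); lia.
    by lia.
  by lia.
elim: m => [|m IHm]; first by rewrite muln0 addr0.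
rewrite -IHm; have := odd1 (- l - (2 * m.+1)%N%:Z); rewrite odd2.
rewrite (_ : 1 - _ = 2 * l + 1 + (4 * m.+1)%N%:Z); last by lia.
by move=> <-; congr (fourier _ _); lia.
Qed.

End Swap.

(** * Block operators *)

Section Blocks.
Context (R : realType).
Local Notation Loo := (@circle_Lp R +oo%E).
Local Notation hardy := (hardy R).
Local Notation hardy2 := (hardy * hardy)%type.
Implicit Types (f g u v : hardy) (x y w : hardy2) (phi psi : R[i] -> R[i]).

Lemma hardy_ipMDl (a : R[i]) f f' g :
  hardy_ip (a *: f + f') g = a * hardy_ip f g + hardy_ip f' g.
Proof.
rewrite !Parseval; apply: ccvg_unique (hardy_ip_cvg _ _) _.
have := ccvgMD a (hardy_ip_cvg f g) (hardy_ip_cvg f' g).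
under [X in ccvg X _ -> _]eq_fun do rewrite big_distrr -big_split.
under [X in _ -> ccvg X _]eq_fun do under eq_bigr => k _ do
  rewrite -[((a *: f + f') k : R[i])]/(a * f k + f' k) mulrDl -mulrA.
by [].
Qed.

Lemma hardy_ipC f g : hardy_ip f g = conjc (hardy_ip g f).
Proof. by rewrite !Parseval (L2_ipC (L2_boundary f) (L2_boundary g)). Qed.

Lemma hardy_ipMDr (a : R[i]) f g g' :
  hardy_ip f (a *: g + g') = conjc a * hardy_ip f g + hardy_ip f g'.
Proof. by rewrite hardy_ipC hardy_ipMDl conjcD conjcM -!hardy_ipC. Qed.

(** For the antiunitary involution C_2, both sides are the bilinear pairing of
    f and g twisted by [swap], which is symmetric. *)
Lemma hardy_ip_swap f g : hardy_ip f (swap_conj g) = hardy_ip g (swap_conj f).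
Proof.
rewrite !Parseval.
apply: ccvg_unique (ccvg_double (hardy_ip_cvg _ _)) _.
apply: (@ccvg_swap _ (fun k => (f k : R[i]) * conjc (swap_conj g k : R[i]))).
have := hardy_ip_cvg g (swap_conj f).
under eq_fun do under eq_bigr do rewrite swap_coef conjcK mulrC.
by under [X in _ -> ccvg X _]eq_fun do under eq_bigr do
  rewrite swap_coef conjcK swapK.
Qed.

Definition sesquilinear (F : hardy -> hardy -> R[i]) : Prop :=
  (forall (a : R[i]) f f' g, F (a *: f + f') g = a * F f g + F f' g) /\
  (forall (a : R[i]) f g g', F f (a *: g + g') = conjc a * F f g + F f g').

Lemma hardy_ip_sesquilinear : sesquilinear (@hardy_ip R).
Proof. by split=> *; [exact: hardy_ipMDl|exact: hardy_ipMDr]. Qed.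

Lemma toeplitz_form_sesquilinear phi :
  Loo phi -> sesquilinear (toeplitz_form phi).
Proof.
by move=> poo; split=> *; [exact: toeplitz_formMDl|exact: toeplitz_formMDr].
Qed.

Section Sesquilinear.
Context (F : hardy -> hardy -> R[i]) (Fsl : sesquilinear F).

Lemma sesqDl f f' g : F (f + f') g = F f g + F f' g.
Proof. by have := Fsl.1 1 f f' g; rewrite scale1r mul1r. Qed.

Lemma sesq0l g : F 0 g = 0.
Proof. by apply: (addrI (F 0 g)); rewrite -sesqDl !addr0. Qed.

Lemma sesqZl a f g : F (a *: f) g = a * F f g.
Proof. by have := Fsl.1 a f 0 g; rewrite sesq0l !addr0. Qed.

Lemma sesqBl f f' g : F (f - f') g = F f g - F f' g.
Proof. by rewrite sesqDl -scaleN1r sesqZl mulN1r. Qed.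

Lemma sesqDr f g g' : F f (g + g') = F f g + F f g'.
Proof. by have := Fsl.2 1 f g g'; rewrite scale1r conjc1 mul1r. Qed.

Lemma sesq0r f : F f 0 = 0.
Proof. by apply: (addrI (F f 0)); rewrite -sesqDr !addr0. Qed.

Lemma sesqZr a f g : F f (a *: g) = conjc a * F f g.
Proof. by have := Fsl.2 a f g 0; rewrite sesq0r !addr0. Qed.

Lemma sesqBr f g g' : F f (g - g') = F f g - F f g'.
Proof.
rewrite sesqDr -scaleN1r sesqZr; congr (_ + _); rewrite -[RHS]mulN1r.
by congr (_ * _); apply: complex_ext; rewrite /= ?oppr0.
Qed.

End Sesquilinear.

Let s : R[i] := (Num.sqrt 2)^-1%:C.

(** The block conjugation inherits the symmetry of C_2 because its matrix of
    scalars is real and symmetric. *)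
Lemma hardy2_ip_block_conj x w :
  hardy2_ip x (block_conj w) = hardy2_ip w (block_conj x).
Proof.
case: x w => [x1 x2] [w1 w2]; rewrite /hardy2_ip /block_conj /= -/s.
have ipsl := hardy_ip_sesquilinear.
rewrite !(sesqZr ipsl) !(sesqBr ipsl) !(sesqDr ipsl).
rewrite [hardy_ip w1 _]hardy_ip_swap [hardy_ip w1 _]hardy_ip_swap.
rewrite [hardy_ip w2 _]hardy_ip_swap [hardy_ip w2 _]hardy_ip_swap.
ring.
Qed.

(** ** The block symmetry as a system of scalar identities *)

Section FourForms.
Context (A B D E : hardy -> hardy -> R[i]).
Context (Asl : sesquilinear A) (Bsl : sesquilinear B).
Context (Dsl : sesquilinear D) (Esl : sesquilinear E).
Local Notation A' := (conj_form A).
Local Notation B' := (conj_form B).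
Local Notation D' := (conj_form D).
Local Notation E' := (conj_form E).

Definition block_form x y : R[i] :=
  (A x.1 y.1 + B x.2 y.1) + (D x.1 y.2 + E x.2 y.2).

(** The factor 2 absorbs the square of 1 / sqrt 2. *)
Lemma block_form_conj x y :
  2 * block_form (block_conj y) (block_conj x) =
  (A' x.1 y.1 + A' x.1 y.2 + A' x.2 y.1 + A' x.2 y.2) +
  (B' x.1 y.1 - B' x.1 y.2 + B' x.2 y.1 - B' x.2 y.2) +
  (D' x.1 y.1 + D' x.1 y.2 - D' x.2 y.1 - D' x.2 y.2) +
  (E' x.1 y.1 - E' x.1 y.2 - E' x.2 y.1 + E' x.2 y.2).
Proof.
rewrite /block_form /block_conj -/s.
case: x y => [x1 x2] [y1 y2] /=.
rewrite !(sesqZl Asl, sesqZl Bsl, sesqZl Dsl, sesqZl Esl).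
rewrite !(sesqZr Asl, sesqZr Bsl, sesqZr Dsl, sesqZr Esl).
rewrite !(sesqDl Asl, sesqBl Bsl, sesqDl Dsl, sesqBl Esl).
rewrite !(sesqDr Asl, sesqDr Bsl, sesqBr Dsl, sesqBr Esl).
have s2 := sqrt2V_sqr R; rewrite -/s in s2.
rewrite /conj_form -[RHS]mul1r -[X in _ = X * _]s2; ring.
Qed.

(** On vectors with one nonzero component, the symmetry is a 4 x 4 linear system
    between the block forms and the conjugated ones; its matrix is, up to scale,
    a Hadamard matrix, and adding and subtracting rows splits it into these
    four equations. *)
Lemma block_form_symmetricP :
  (forall x y, block_form x y = block_form (block_conj y) (block_conj x)) <->
  [/\ forall f g, A f g + B f g = A' f g + B' f g,
      forall f g, D f g - E f g = D' f g - E' f g,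
      forall f g, A f g - B f g = D' f g + E' f g &
      forall f g, D f g + E f g = A' f g - B' f g].
Proof.
have two0 : 2 != 0 :> R[i] by rewrite pnatr_eq0.
split=> [sym|[e1 e2 e3 e4]]; last first.
  move=> x y; apply: (mulfI two0); rewrite block_form_conj /block_form.
  have split2 (a b c d : R[i]) : a + b = c -> a - b = d ->
      2 * a = c + d /\ 2 * b = c - d.
    by move=> <- <-; split; ring.
  have eAB f g := split2 _ _ _ _ (e1 f g) (e3 f g).
  have eDE f g := split2 _ _ _ _ (e4 f g) (e2 f g).
  rewrite !mulrDr (eAB _ _).1 (eAB _ _).2 (eDE _ _).1 (eDE _ _).2; ring.
have eq x y := etrans (congr1 (fun z => 2 * z) (sym x y)) (block_form_conj x y).
have z0 := (sesq0l Asl, sesq0l Bsl, sesq0l Dsl, sesq0l Esl).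
have z1 := (sesq0r Asl, sesq0r Bsl, sesq0r Dsl, sesq0r Esl).
have e11 f g := eq (f, 0) (g, 0); have e21 f g := eq (0, f) (g, 0).
have e12 f g := eq (f, 0) (0, g); have e22 f g := eq (0, f) (0, g).
have both f g :
    [/\ 2 * A f g = (A' f g + B' f g) + (D' f g + E' f g),
        2 * B f g = (A' f g + B' f g) - (D' f g + E' f g),
        2 * D f g = (A' f g - B' f g) + (D' f g - E' f g) &
        2 * E f g = (A' f g - B' f g) - (D' f g - E' f g)].
  move: (e11 f g) (e21 f g) (e12 f g) (e22 f g).
  rewrite /block_form /conj_form /= !swap_conj0 !z0 !z1.
  rewrite !(addr0, add0r, subr0, sub0r).
  by move=> -> -> -> ->; split; ring.
split=> f g; apply: (mulfI two0); have [a b d e] := both f g;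
  by rewrite ?mulrDr ?mulrN ?a ?b ?d ?e; ring.
Qed.

End FourForms.

Lemma hardy2_ip_block_toeplitz (Phi : 'M[R[i] -> R[i]]_2) x y :
  (forall i j : 'I_2, Loo (Phi i j)) ->
  hardy2_ip (block_toeplitz Phi x) y =
  block_form (toeplitz_form (Phi 0 0)) (toeplitz_form (Phi 0 1))
    (toeplitz_form (Phi 1 0)) (toeplitz_form (Phi 1 1)) x y.
Proof.
move=> HPhi; have ipD := sesqDl hardy_ip_sesquilinear.
by congr (_ + _); apply: etrans (ipD _ _ _) _; congr (_ + _);
  apply: toeplitz_formE.
Qed.

(** The symmetry of the conjugation turns <x, C T_Phi C y> into the block form
    at (C y, C x). *)
Lemma complex_symmetricP (Phi : 'M[R[i] -> R[i]]_2)
    (A := toeplitz_form (Phi 0 0)) (B := toeplitz_form (Phi 0 1))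
    (D := toeplitz_form (Phi 1 0)) (E := toeplitz_form (Phi 1 1)) :
  (forall i j : 'I_2, Loo (Phi i j)) ->
  complex_symmetric (@hardy2_ip R) (@block_conj R) (block_toeplitz Phi) <->
  [/\ forall f g, A f g + B f g = conj_form A f g + conj_form B f g,
      forall f g, D f g - E f g = conj_form D f g - conj_form E f g,
      forall f g, A f g - B f g = conj_form D f g + conj_form E f g &
      forall f g, D f g + E f g = conj_form A f g - conj_form B f g].
Proof.
move=> HPhi.
have sl i j := toeplitz_form_sesquilinear (HPhi i j).
apply: iff_trans (block_form_symmetricP (sl 0 0) (sl 0 1) (sl 1 0) (sl 1 1)).
have T := fun x y => hardy2_ip_block_toeplitz x y HPhi.
split=> sym x y.
  have := sym x y; rewrite T => ->.
  by rewrite [LHS]hardy2_ip_block_conj T.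
by rewrite T sym [RHS]hardy2_ip_block_conj T.
Qed.

End Blocks.

Theorem theorem4p1 (R : realType) (Phi : 'M[R[i] -> R[i]]_2)
    (HPhi : forall i j : 'I_2, circle_Lp +oo%E (Phi i j)) :
  let phi1 := Phi 0 0 in let phi2 := Phi 0 1 in
  let phi3 := Phi 1 0 in let phi4 := Phi 1 1 in
  complex_symmetric (@hardy2_ip R) (@block_conj R) (block_toeplitz Phi) <->
  forall l : int,
    [/\ fourier (phi1 \+ phi2) (2 * l) = fourier (phi1 \+ phi2) (- (2 * l)),
        fourier (phi3 \- phi4) (2 * l) = fourier (phi3 \- phi4) (- (2 * l)),
        fourier (phi1 \- phi2) (2 * l) = fourier (phi3 \+ phi4) (- (2 * l))
      & forall i j : 'I_2, fourier (Phi i j) (2 * l + 1) = 0].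
Proof.
move=> phi1 phi2 phi3 phi4.
have h1 : circle_Lp +oo%E phi1 := HPhi 0 0.
have h2 : circle_Lp +oo%E phi2 := HPhi 0 1.
have h3 : circle_Lp +oo%E phi3 := HPhi 1 0.
have h4 : circle_Lp +oo%E phi4 := HPhi 1 1.
have h12 := LinfD h1 h2; have h12' := LinfB h1 h2.
have h34 := LinfD h3 h4; have h34' := LinfB h3 h4.
have P12 := toeplitz_form_swapP h12 h12.
have P34 := toeplitz_form_swapP h34' h34'.
have Pl := toeplitz_form_swapP h12' h34.
have Pr := toeplitz_form_swapP h34 h12'.
apply: iff_trans (complex_symmetricP HPhi) _; split.
- move=> [e1 e2 e3 e4] l.
  have /P12 e1' : forall f g,
      toeplitz_form (phi1 \+ phi2) f g =
      conj_form (toeplitz_form (phi1 \+ phi2)) f g.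
    by move=> f g; rewrite /conj_form !toeplitz_form_symbolD//; exact: e1.
  have /P34 e2' : forall f g,
      toeplitz_form (phi3 \- phi4) f g =
      conj_form (toeplitz_form (phi3 \- phi4)) f g.
    by move=> f g; rewrite /conj_form !toeplitz_form_symbolB//; exact: e2.
  have /Pl e3' : forall f g,
      toeplitz_form (phi1 \- phi2) f g =
      conj_form (toeplitz_form (phi3 \+ phi4)) f g.
    move=> f g; rewrite /conj_form toeplitz_form_symbolB//.
    by rewrite toeplitz_form_symbolD//; exact: e3.
  have [a1 a2 _] := e1' l; have [b1 b2 _] := e2' l.
  have [c1 c2 c3] := e3' l.
  have both0 (p q : R[i]) : p + q = 0 -> p - q = 0 -> p = 0 /\ q = 0.
    move=> /(canRL (addrK _)); rewrite sub0r => -> /eqP.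
    rewrite -opprD oppr_eq0 -mulr2n -mulr_natl mulf_eq0 pnatr_eq0 /= => /eqP ->.
    by rewrite oppr0.
  rewrite !fourierD// in a2 c3; rewrite !fourierB// in b2 c2.
  have [f1 f2] := both0 _ _ a2 c2; have [f3 f4] := both0 _ _ c3 b2.
  split => // i j.
  have ord2 (k : 'I_2) : k = 0 \/ k = 1.
    by case: k => [[|[|//]] hk]; [left|right]; apply: val_inj.
  by case: (ord2 i) (ord2 j) => -> [] ->.
- move=> H.
  have odd i j l : fourier (Phi i j) (2 * l + 1) = 0 by have [_ _ _ ->] := H l.
  have odd12 l : fourier (phi1 \+ phi2) (2 * l + 1) = 0.
    by rewrite (fourierD _ h1 h2) !odd addr0.
  have odd12' l : fourier (phi1 \- phi2) (2 * l + 1) = 0.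
    by rewrite (fourierB _ h1 h2) !odd subr0.
  have odd34 l : fourier (phi3 \+ phi4) (2 * l + 1) = 0.
    by rewrite (fourierD _ h3 h4) !odd addr0.
  have odd34' l : fourier (phi3 \- phi4) (2 * l + 1) = 0.
    by rewrite (fourierB _ h3 h4) !odd subr0.
  (* The fourth scalar identity is the third equation read at - l. *)
  have even3 l : fourier (phi3 \+ phi4) (2 * l) =
      fourier (phi1 \- phi2) (- (2 * l)).
    by have [_ _ e _] := H (- l); rewrite mulrN opprK in e; exact: esym.
  have e1 := P12.2
    (fun l => And3 (let: And4 e _ _ _ := H l in e) (odd12 l) (odd12 l)).
  have e2 := P34.2
    (fun l => And3 (let: And4 _ e _ _ := H l in e) (odd34' l) (odd34' l)).
  have e3 := Pl.2
    (fun l => And3 (let: And4 _ _ e _ := H l in e) (odd12' l) (odd34 l)).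
  have e4 := Pr.2 (fun l => And3 (even3 l) (odd34 l) (odd12' l)).
  have D12 f g := toeplitz_form_symbolD f g h1 h2.
  have B12 f g := toeplitz_form_symbolB f g h1 h2.
  have D34 f g := toeplitz_form_symbolD f g h3 h4.
  have B34 f g := toeplitz_form_symbolB f g h3 h4.
  split=> f g.
  + exact: etrans (esym (D12 f g)) (etrans (e1 f g) (D12 _ _)).
  + exact: etrans (esym (B34 f g)) (etrans (e2 f g) (B34 _ _)).
  + exact: etrans (esym (B12 f g)) (etrans (e3 f g) (D34 _ _)).
  + exact: etrans (esym (D34 f g)) (etrans (e4 f g) (B12 _ _)).
Qed.
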